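(* Assume (A1)–(A2) and $N\geq \max\{1,\|f\|_\infty/2\}$. Let $v^h$ be the solution of the semi-discrete HJB equation and $v$ the viscosity solution of the HJB equation, as in the context. Then there exists a universal constant $C>0$ such that \[ \sup_{(t,x)\in [0,T]\times \mathbb{R}^d} |v(t,x)-v^h(t,x)|\leq C(1+T)(1+\|\nabla v\|_\infty) \sqrt{h}. \] In particular, $\sup_{(t,x)\in [0,T]\times \mathbb{R}^d} |v(t,x)-v^h(t,x)|\leq C\exp(CT) \sqrt{h}$.
   Context: Let $d,m\ge1$, $T\ge 1$, $A\subset\mathbb{R}^m$ compact, $c:[0,T]\times\mathbb{R}^d\times A\to\mathbb{R}$, $f:[0,T]\times\mathbb{R}^d\times A\to\mathbb{R}^d$, $q:\mathbb{R}^d\to\mathbb{R}$. Let $\alpha(t,x,p)=\operatorname{argmin}_{a\in A}[c(t,x,a)+p\cdot f(t,x,a)]$, assumed to be the unique minimizer, and $H(t,x,p)=\min_{a\in A}[c(t,x,a)+p\cdot f(t,x,a)]$. Assumptions: (A1) $c,f,q$ are uniformly bounded and Lipschitz continuous in all their variables; (A2) $\alpha(\cdot,\cdot,\cdot)$ and a given continuous initial policy $\alpha_0$ are uniformly Lipschitz continuous in all their variables. For $\varphi:\mathbb{R}^d\to\mathbb{R}$, $h\in(0,1)$: $\nabla^h\varphi(x)=\big(\frac{\varphi(x+he_i)-\varphi(x-he_i)}{2h}\big)_{i=1}^d$, $\Delta^h\varphi(x)=\sum_{i=1}^d\frac{\varphi(x+he_i)-2\varphi(x)+\varphi(x-he_i)}{h^2}$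 (acting in $x$). $v^h$ is the solution of $\partial_t v^h+H(t,x,\nabla^h v^h)=-Nh\Delta^h v^h$ in $(0,T)\times\mathbb{R}^d$, $v^h(T,x)=q(x)$; $v$ is the viscosity solution of $\partial_t v+H(t,x,\nabla v)=0$ in $(0,T)\times\mathbb{R}^d$, $v(T,x)=q(x)$ (equivalently, the value function $v(t,x)=\inf\{\int_t^T c(s,x_s,\alpha_s)ds+q(x_T)\}$ over measurable $\alpha:[t,T]\to A$, with $\dot x_s=f(s,x_s,\alpha_s)$, $x_t=x$). A constant is universal if it depends only on $d$, $N$ and the constants in (A1)–(A2). *)

(* Defs.v *)
From HB Require Import structures.
From mathcomp Require Import all_boot all_order all_algebra.
From mathcomp Require Import all_classical all_reals all_analysis.
Set Implicit Arguments. Unset Strict Implicit. Unset Printing Implicit Defensive.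
Import Order.TTheory GRing.Theory Num.Theory.
Import numFieldNormedType.Exports.
Local Open Scope classical_set_scope.
Local Open Scope ring_scope.

Section Defs.
Variable R : realType.

Definition dotv (n : nat) (p u : 'rV[R]_n) : R := \sum_(i < n) p 0 i * u 0 i.
Definition enorm (n : nat) (x : 'rV[R]_n) : R := Num.sqrt (dotv x x).

Definition evec (n : nat) (i : 'I_n) : 'rV[R]_n := delta_mx 0 i.

Definition gradh (d : nat) (h : R) (phi : 'rV[R]_d -> R) (x : 'rV[R]_d) : 'rV[R]_d :=
  \row_(i < d) ((phi (x + h *: evec i) - phi (x - h *: evec i)) / (2 * h)).
Definition laplh (d : nat) (h : R) (phi : 'rV[R]_d -> R) (x : 'rV[R]_d) : R :=
  \sum_(i < d) ((phi (x + h *: evec i) - 2 * phi x + phi (x - h *: evec i)) / h ^+ 2).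

Definition Ham (d m : nat) (A : set 'rV[R]_m)
  (c : R -> 'rV[R]_d -> 'rV[R]_m -> R) (f : R -> 'rV[R]_d -> 'rV[R]_m -> 'rV[R]_d)
  (t : R) (x p : 'rV[R]_d) : R :=
  inf [set c t x a + dotv p (f t x a) | a in A].

Definition assumption_A1 (d m : nat) (L T : R) (A : set 'rV[R]_m)
  (c : R -> 'rV[R]_d -> 'rV[R]_m -> R) (f : R -> 'rV[R]_d -> 'rV[R]_m -> 'rV[R]_d)
  (q : 'rV[R]_d -> R) : Prop :=
  (forall t x a, t \in `[0, T] -> A a ->
     `|c t x a| <= L /\ enorm (f t x a) <= L) /\
  (forall x, `|q x| <= L) /\
  (forall t t' x x' a a', t \in `[0, T] -> t' \in `[0, T] -> A a -> A a' ->
     `|c t x a - c t' x' a'| <= L * (`|t - t'| + enorm (x - x') + enorm (a - a')) /\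
     enorm (f t x a - f t' x' a') <= L * (`|t - t'| + enorm (x - x') + enorm (a - a'))) /\
  (forall x x', `|q x - q x'| <= L * enorm (x - x')).

Definition assumption_A2 (d m : nat) (L T : R) (A : set 'rV[R]_m)
  (c : R -> 'rV[R]_d -> 'rV[R]_m -> R) (f : R -> 'rV[R]_d -> 'rV[R]_m -> 'rV[R]_d)
  (alpha : R -> 'rV[R]_d -> 'rV[R]_d -> 'rV[R]_m)
  (alpha0 : R -> 'rV[R]_d -> 'rV[R]_m) : Prop :=
  (forall t x p, t \in `[0, T] ->
     A (alpha t x p) /\
     forall a, A a -> a <> alpha t x p ->
       c t x (alpha t x p) + dotv p (f t x (alpha t x p)) < c t x a + dotv p (f t x a)) /\
  (forall t t' x x' p p', t \in `[0, T] -> t' \in `[0, T] ->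
     enorm (alpha t x p - alpha t' x' p')
       <= L * (`|t - t'| + enorm (x - x') + enorm (p - p'))) /\
  (forall t x, t \in `[0, T] -> A (alpha0 t x)) /\
  (forall t t' x x', t \in `[0, T] -> t' \in `[0, T] ->
     enorm (alpha0 t x - alpha0 t' x') <= L * (`|t - t'| + enorm (x - x'))).

Definition semidiscrete_solution (d m : nat) (N h T : R) (A : set 'rV[R]_m)
  (c : R -> 'rV[R]_d -> 'rV[R]_m -> R) (f : R -> 'rV[R]_d -> 'rV[R]_m -> 'rV[R]_d)
  (q : 'rV[R]_d -> R) (vh : R -> 'rV[R]_d -> R) : Prop :=
  (exists M : R, forall t x, t \in `[0, T] -> `|vh t x| <= M) /\
  (forall x, {within `[0, T], continuous (fun s => vh s x)}) /\
  (forall x t, t \in `]0, T[ ->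
     is_derive t 1 (fun s => vh s x)
       (- Ham A c f t x (gradh h (vh t) x) - N * h * laplh h (vh t) x)) /\
  (forall x, vh T x = q x).

Definition admissible_control (m : nat) (A : set 'rV[R]_m) (t T : R)
  (al : R -> 'rV[R]_m) : Prop :=
  (forall j : 'I_m, measurable_fun `[t, T] (fun s => al s 0 j)) /\
  (forall s, s \in `[t, T] -> A (al s)).

Definition trajectory (d m : nat) (f : R -> 'rV[R]_d -> 'rV[R]_m -> 'rV[R]_d)
  (t T : R) (x0 : 'rV[R]_d) (al : R -> 'rV[R]_m) (X : R -> 'rV[R]_d) : Prop :=
  {within `[t, T], continuous X} /\ X t = x0 /\
  forall s, s \in `[t, T] -> forall i : 'I_d,
    ((X s) 0 i)%:E = ((x0 0 i)%:E
      + \int[lebesgue_measure]_(r in `[t, s]) ((f r (X r) (al r)) 0 i)%:E)%E.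

Definition value_function (d m : nat) (T : R) (A : set 'rV[R]_m)
  (c : R -> 'rV[R]_d -> 'rV[R]_m -> R) (f : R -> 'rV[R]_d -> 'rV[R]_m -> 'rV[R]_d)
  (q : 'rV[R]_d -> R) (t : R) (x : 'rV[R]_d) : R :=
  inf [set J | exists (al : R -> 'rV[R]_m) (X : R -> 'rV[R]_d),
         admissible_control A t T al /\ trajectory f t T x al X /\
         J = Rintegral lebesgue_measure `[t, T] (fun s => c s (X s) (al s)) + q (X T)].

End Defs.

(* Main.v *)
Require Import Defs.
From mathcomp Require Import all_boot all_order all_algebra.
From mathcomp Require Import all_classical all_reals all_analysis.
From mathcomp Require Import measurable_realfun.
From mathcomp Require Import ring lra.
Set Implicit Arguments.
Unset Strict Implicit.
Unset Printing Implicit Defensive.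
Import Order.TTheory GRing.Theory Num.Theory.
Import numFieldNormedType.Exports.
Local Open Scope classical_set_scope.
Local Open Scope ring_scope.

(** The value function is compared with the semidiscrete solution by doubling the
space variable: for [sigma = 1] and [sigma = -1], let [M s] be the supremum over
[x], [y] of [sigma * (vh s y - v s x) - |x - y|^2 / (2 ep)]. It is enough to
compare [M s] with [M u] for [u] slightly larger than [s]. Along an almost maximal
pair, dynamic programming controls [v] (an almost optimal control for [sigma = 1],
a constant one for [sigma = -1]), while the mean value theorem in time and
the monotonicity of the scheme, guaranteed by [|f| <= 2 N],
control [vh]; since [v] is [Lv]-Lipschitz, [|x - y| <= 2 ep (1 + Lv)]. This yields
  [M s <= M u + (u - s) * (d N h / ep + O(ep (1 + Lv)^2)) + O((u - s)^2)],
and subdividing [[t, T]] ever more finely removes the quadratic error. The choice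
[ep = sqrt h / (1 + Lv)] gives the rate. For the second estimate, the Lipschitz
constant of [v] is at most doubled, up to an additive constant, on each time
interval of a fixed length depending only on [d] and [L], hence is at most
exponential in [T]. *)

(** * Euclidean and l1 norms of row vectors *)

Section Vectors.
Context {R : realType} {n : nat}.
Implicit Types (x y u p w : 'rV[R]_n) (k : R).

Definition l1norm (x : 'rV[R]_n) : R := \sum_(i < n) `|x 0 i|.

Lemma l1norm_ge0 x : 0 <= l1norm x.
Proof. exact: sumr_ge0. Qed.

Lemma ler_l1normD x y : l1norm (x + y) <= l1norm x + l1norm y.
Proof.
rewrite /l1norm -big_split /=; apply: ler_sum => i _.
by rewrite mxE; exact: ler_normD.
Qed.

Lemma sumr_cst_ord k : \sum_(i < n) k = n%:R * k.
Proof. by rewrite sumr_const card_ord mulr_natl. Qed.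

Lemma l1norm_le_cst x k : (forall i, `|x 0 i| <= k) -> l1norm x <= n%:R * k.
Proof.
move=> xk; apply: (le_trans (ler_sum _ (fun i _ => xk i))).
by rewrite sumr_cst_ord.
Qed.

Lemma dotvDr p x y : dotv p (x + y) = dotv p x + dotv p y.
Proof.
by rewrite /dotv -big_split; apply: eq_bigr => i _; rewrite mxE mulrDr.
Qed.

Lemma dotvC x y : dotv x y = dotv y x.
Proof. by apply: eq_bigr => i _; rewrite mulrC. Qed.

Lemma dotvZl k x y : dotv (k *: x) y = k * dotv x y.
Proof. by rewrite /dotv mulr_sumr; apply: eq_bigr => i _; rewrite mxE mulrA. Qed.

Lemma dotvBr p x y : dotv p (x - y) = dotv p x - dotv p y.
Proof.
by rewrite /dotv -sumrB; apply: eq_bigr => i _; rewrite !mxE mulrBr.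
Qed.

Lemma dotv_ge0 x : 0 <= dotv x x.
Proof. by apply: sumr_ge0 => i _; rewrite -expr2 sqr_ge0. Qed.

Lemma dotvDD x y : dotv (x + y) (x + y) = dotv x x + 2 * dotv x y + dotv y y.
Proof. by rewrite dotvDr !(dotvC (x + y)) !dotvDr (dotvC y x); ring. Qed.

Lemma dotv_evec x i : dotv x (evec R i) = x 0 i.
Proof.
rewrite /dotv (bigD1 i)//= big1 => [|j ji].
  by rewrite mxE !eqxx mulr1 addr0.
by rewrite mxE eqxx (negbTE ji) mulr0.
Qed.

Lemma enorm_ge0 x : 0 <= enorm x.
Proof. exact: sqrtr_ge0. Qed.

Lemma enorm_sqr x : enorm x ^+ 2 = dotv x x.
Proof. by rewrite sqr_sqrtr// dotv_ge0. Qed.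

Lemma enormN x : enorm (- x) = enorm x.
Proof.
by rewrite /enorm; congr Num.sqrt; apply: eq_bigr => i _; rewrite !mxE mulrNN.
Qed.

Lemma enormB x y : enorm (x - y) = enorm (y - x).
Proof. by rewrite -enormN opprB. Qed.

Lemma enormZ k x : 0 <= k -> enorm (k *: x) = k * enorm x.
Proof.
move=> k0; rewrite /enorm dotvZl dotvC dotvZl mulrA -expr2.
by rewrite sqrtrM ?sqr_ge0// sqrtr_sqr ger0_norm.
Qed.

Lemma enorm0 : enorm (0 : 'rV[R]_n) = 0.
Proof. by rewrite -(scale0r 0) enormZ// mul0r. Qed.

Lemma coord_le_enorm x i : `|x 0 i| <= enorm x.
Proof.
rewrite -ler_sqr ?nnegrE ?enorm_ge0// enorm_sqr real_normK ?num_real//.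
rewrite /dotv (bigD1 i)//= -expr2 lerDl; apply: sumr_ge0 => j _.
by rewrite -expr2 sqr_ge0.
Qed.

Lemma l1norm_le_enorm x : l1norm x <= n%:R * enorm x.
Proof. by apply: l1norm_le_cst => i; exact: coord_le_enorm. Qed.

Lemma enorm_le_l1norm x : enorm x <= l1norm x.
Proof.
rewrite -ler_sqr ?nnegrE ?enorm_ge0 ?l1norm_ge0// enorm_sqr expr2 mulr_sumr.
apply: ler_sum => i _; rewrite -expr2 -real_normK ?num_real// expr2.
apply: ler_wpM2r => //; rewrite /l1norm (bigD1 i)//= lerDl.
exact: sumr_ge0.
Qed.

(** Cauchy-Schwarz: the one-sided bound is proved for all vectors, and applying it to [- p] gives
    the other sign. *)
Lemma dotv_le p u : `|dotv p u| <= enorm p * enorm u.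
Proof.
have wlog_pos q w : dotv q w <= enorm q * enorm w.
  have [q0|q0] := eqVneq (enorm q) 0.
    rewrite q0 mul0r /dotv big1// => i _.
    have := coord_le_enorm q i; rewrite q0 normr_le0 => /eqP ->.
    by rewrite mul0r.
  have q0' : 0 < enorm q by rewrite lt_def q0 enorm_ge0.
  set k := enorm w / enorm q.
  (* expand 0 <= |w - k q|^2 *)
  have := dotv_ge0 (w + (- k) *: q).
  rewrite dotvDD dotvZl (dotvC w) dotvZl (dotvC q (_ *: _)) dotvZl -!enorm_sqr.
  move=> H.
  have [w0|w0] := eqVneq (enorm w) 0.
    rewrite w0 mulr0 /dotv big1// => i _.
    have := coord_le_enorm w i; rewrite w0 normr_le0 => /eqP ->.
    by rewrite mulr0.
  have w0' : 0 < enorm w by rewrite lt_def w0 enorm_ge0.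
  have k0 : 0 < k by rewrite divr_gt0.
  have Ew : enorm w = k * enorm q by rewrite /k divfK.
  move: H; rewrite Ew => H; rewrite -(ler_pM2l k0); nra.
rewrite ler_norml wlog_pos andbT lerNl.
by have := wlog_pos (- p) u; rewrite enormN -scaleN1r dotvZl mulN1r.
Qed.

End Vectors.

(** * Integrals of bounded measurable functions on compact intervals *)

Section Integrals.
Context {R : realType}.
Local Notation mu := (@lebesgue_measure R).
Implicit Types (g : R -> R) (a b s t u k B : R).

(** The class of integrands used for all costs and drifts: closed under restriction, sums and
    scaling, and integrable because the interval has finite measure. *)
Definition bounded_measurable a b g :=
  measurable_fun `[a, b] g /\ exists B, forall r, r \in `[a, b] -> `|g r| <= B.

Lemma bounded_measurableS a b s t g : a <= s -> t <= b ->
  bounded_measurable a b g -> bounded_measurable s t g.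
Proof.
move=> as_ tb [mg [B gB]]; split.
  apply: measurable_funS mg => // r /=; rewrite !in_itv/= => /andP[sr rt].
  by rewrite (le_trans as_ sr) (le_trans rt tb).
exists B => r; rewrite in_itv/= => /andP[sr rt]; apply: gB.
by rewrite in_itv/= (le_trans as_ sr) (le_trans rt tb).
Qed.

Lemma lebesgue_itvcc a b : a <= b -> mu `[a, b]%classic = (b - a)%:E.
Proof.
rewrite le_eqVlt => /predU1P[->|ab].
  by rewrite lebesgue_measure_itv/= ltxx subrr.
by rewrite lebesgue_measure_itv/= lte_fin ab EFinB.
Qed.

Lemma lebesgue_itvcc_lty a b : (mu `[a, b]%classic < +oo)%E.
Proof.
rewrite lebesgue_measure_itv/=; case: ifP => _; last exact: ltry.
by rewrite -EFinB ltry.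
Qed.

Lemma bounded_measurable_integrable a b g : bounded_measurable a b g ->
  mu.-integrable `[a, b] (EFin \o g).
Proof.
move=> [mg [B gB]]; apply: measurable_bounded_integrable => //.
  exact: lebesgue_itvcc_lty.
exists B; split; first exact: num_real.
by move=> M BM r /= rab; apply: (le_trans (gB r rab)); exact: ltW.
Qed.

(** Such integrals are finite, so the extended-real equation in [trajectory] can be handled as an
    equation in [R]. *)
Lemma EFin_Rintegral a b g : bounded_measurable a b g ->
  ((\int[mu]_(r in `[a, b]) g r)%:E = \int[mu]_(r in `[a, b]) (g r)%:E)%E.
Proof.
move=> /bounded_measurable_integrable ig.
by rewrite fineK//; exact: integrable_fin_num.
Qed.

Lemma Rintegral_concat a s b g : a <= s -> s <= b -> bounded_measurable a b g ->
  \int[mu]_(r in `[a, b]) g r =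
  \int[mu]_(r in `[a, s]) g r + \int[mu]_(r in `[s, b]) g r.
Proof.
move=> as_ sb bg; have ig := bounded_measurable_integrable bg.
have := @Rintegral_itvB R g (BLeft a) (BRight b) s ig.
rewrite !bnd_simp => /(_ as_ sb) e.
apply/eqP; rewrite addrC -subr_eq e Rintegral_itv_obnd_cbnd//.
apply: integrableS ig => // r /=; rewrite !in_itv/= => /andP[sr ->].
by rewrite (le_trans as_ (ltW sr)).
Qed.

Lemma Rintegral_point a g : \int[mu]_(r in `[a, a]) g r = 0.
Proof. by rewrite set_itv1 Rintegral_set1. Qed.

Lemma bounded_measurable_cst a b k : bounded_measurable a b (cst k).
Proof. by split => //; exists `|k|. Qed.

Lemma Rintegral_itv_cst a b k : a <= b -> \int[mu]_(r in `[a, b]) k = k * (b - a).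
Proof. move=> ab; rewrite Rintegral_cst//; congr (_ * _).
by rewrite -[RHS]/(fine (b - a)%:E) -lebesgue_itvcc. Qed.

Lemma ge_Rintegral_itv a b g k : a <= b -> bounded_measurable a b g ->
  (forall r, r \in `[a, b] -> k <= g r) ->
  k * (b - a) <= \int[mu]_(r in `[a, b]) g r.
Proof.
move=> ab bg kg; rewrite -Rintegral_itv_cst//; apply: le_Rintegral => //.
- exact/bounded_measurable_integrable/bounded_measurable_cst.
- exact: bounded_measurable_integrable.
Qed.

Lemma bounded_measurableZ a b g k : bounded_measurable a b g ->
  bounded_measurable a b (fun r => k * g r).
Proof.
move=> [mg [B gB]]; split; first exact: measurable_funM.
exists (`|k| * B) => r rab; rewrite normrM; apply: ler_wpM2l => //; exact: gB.
Qed.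

Lemma bounded_measurableD a b g g' : bounded_measurable a b g ->
  bounded_measurable a b g' -> bounded_measurable a b (fun r => g r + g' r).
Proof.
move=> [mg [B gB]] [mg' [B' gB']]; split; first exact: measurable_funD.
exists (B + B') => r rab; apply: (le_trans (ler_normD _ _)).
by apply: lerD; [exact: gB | exact: gB'].
Qed.

Lemma Rintegral_itvZ a b g k : bounded_measurable a b g ->
  \int[mu]_(r in `[a, b]) (k * g r) = k * \int[mu]_(r in `[a, b]) g r.
Proof. by move=> bg; rewrite RintegralZl//; exact: bounded_measurable_integrable. Qed.

Lemma Rintegral_itvD a b g g' : bounded_measurable a b g ->
  bounded_measurable a b g' ->
  \int[mu]_(r in `[a, b]) (g r + g' r) =
  \int[mu]_(r in `[a, b]) g r + \int[mu]_(r in `[a, b]) g' r.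
Proof. by move=> bg bg'; rewrite RintegralD//; exact: bounded_measurable_integrable. Qed.

Lemma bounded_measurable_sum (I : finType) a b (G : I -> R -> R) :
  (forall i, bounded_measurable a b (G i)) ->
  bounded_measurable a b (fun r => \sum_i G i r).
Proof.
move=> bG; split; first by apply: measurable_sum => i; exact: (bG i).1.
(* [xget] selects one bound for each [i], so that the selected bounds can be added. *)
exists (\sum_i xget 0 [set B | forall r, r \in `[a, b] -> `|G i r| <= B]) => r rab.
apply: (le_trans (ler_norm_sum _ _ _)); apply: ler_sum => i _.
have [_ [B hB]] := bG i.
have := @xgetPex _ 0 [set B | forall r, r \in `[a, b] -> `|G i r| <= B].
by move=> /(_ (ex_intro _ _ hB)) /=; exact.
Qed.

Lemma Rintegral_itv_sum (I : finType) a b (G : I -> R -> R) :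
  (forall i, bounded_measurable a b (G i)) ->
  \int[mu]_(r in `[a, b]) (\sum_i G i r) = \sum_i \int[mu]_(r in `[a, b]) G i r.
Proof.
move=> bG.
(* The induction carries boundedness and measurability of the partial sums along with the identity,
   since additivity of the integral needs them. *)
suff [] : bounded_measurable a b (fun r => \sum_i G i r) /\
   \int[mu]_(r in `[a, b]) (\sum_i G i r) = \sum_i \int[mu]_(r in `[a, b]) G i r by [].
elim: (index_enum I) => [|i l [bl IH]].
  have -> : (fun r => \sum_(i <- [::]) G i r) = cst 0.
    by apply/funext => r; rewrite big_nil.
  rewrite big_nil; split; first exact: bounded_measurable_cst.
  by rewrite Rintegral_cst// mul0r.
have -> : (fun r => \sum_(j <- i :: l) G j r) =
          (fun r => G i r + \sum_(j <- l) G j r).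
  by apply/funext => r; rewrite big_cons.
split; first exact: bounded_measurableD.
by rewrite big_cons Rintegral_itvD// IH.
Qed.

Lemma norm_Rintegral_itv a b g k : a <= b -> bounded_measurable a b g ->
  (forall r, r \in `[a, b] -> `|g r| <= k) ->
  `|\int[mu]_(r in `[a, b]) g r| <= k * (b - a).
Proof.
move=> ab bg gk; rewrite ler_norml; apply/andP; split.
  rewrite -mulNr; apply: ge_Rintegral_itv => // r /gk.
  by rewrite ler_norml => /andP[].
rewrite -lerN2 -[leRHS]mulN1r -Rintegral_itvZ// -mulNr.
apply: ge_Rintegral_itv => // [|r /gk]; first exact: bounded_measurableZ.
by rewrite mulN1r lerN2 => /(le_trans (ler_norm _)).
Qed.

Lemma norm_RintegralB_itv a b g g' k : a <= b -> bounded_measurable a b g ->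
  bounded_measurable a b g' ->
  (forall r, r \in `[a, b] -> `|g r - g' r| <= k) ->
  `|\int[mu]_(r in `[a, b]) g r - \int[mu]_(r in `[a, b]) g' r| <= k * (b - a).
Proof.
move=> ab bg bg' gk.
have bN : bounded_measurable a b (fun r => -1 * g' r) by exact: bounded_measurableZ.
rewrite -[X in _ - X]mul1r -mulNr -Rintegral_itvZ// -Rintegral_itvD//.
apply: norm_Rintegral_itv => //; first exact: bounded_measurableD.
by move=> r /gk; rewrite mulN1r.
Qed.

End Integrals.

(* The strict sublevel sets of [G] are countable unions of preimages under [U]
   of boxes with rational centre and radius. *)
Lemma measurable_fun_lipschitz (R : realType) (I : finType) (D : set R)
    (U : I -> R -> R) (G : R -> R) (K : R) :
  measurable D -> 0 <= K -> (forall i, measurable_fun D (U i)) ->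
  (forall r r', D r -> D r' -> `|G r - G r'| <= K * \sum_i `|U i r - U i r'|) ->
  measurable_fun D G.
Proof.
move=> mD K0 mU GU.
apply: (measurability _ (RGenInftyO.measurableE R)) => _ [_ [y ->] <-].
pose box (k : {ffun I -> rat} * rat) : set R :=
  [set r | D r /\ forall i, `|U i r - ratr (k.1 i)| < ratr k.2].
pose good k := forall r, box k r -> G r < y.
have -> : D `&` G @^-1` `]-oo, y[ =
    \bigcup_k [set r | box k r /\ good k].
  apply/seteqP; split => [r [Dr]|r [k _ [br gk]]]; last first.
    by split; [case: br | rewrite /= in_itv/=; exact: gk].
  rewrite /= in_itv/= => Gry.
  pose S : R := (#|I|)%:R; have S0 : 0 <= S by rewrite /S.
  have D0 : 0 < 2 * K * S + 1 by rewrite ltr_wpDl ?mulr_ge0.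
  (* A box of radius [rho] around the values [U i r] moves [G] by at most [2 * K * S * rho], which
     this choice keeps below [y - G r]; the [+ 1] avoids a zero denominator. *)
  have e0 : 0 < (y - G r) / (2 * K * S + 1) by rewrite divr_gt0 ?subr_gt0.
  have [rho] := rat_in_itvoo e0; rewrite in_itv/= => /andP[rho0 rhoe].
  have qex i : exists q : rat, `|U i r - ratr q| < ratr rho.
    have [q] := @rat_in_itvoo R (U i r - ratr rho) (U i r + ratr rho) ltac:(lra).
    by rewrite in_itv/= => ?; exists q; rewrite ltr_norml; lra.
  have [q hq] := choice qex.
  exists ([ffun i => q i], rho) => //; split => [|r' [Dr' br']].
    by split => // i; rewrite ffunE.
  have sumle : \sum_i `|U i r' - U i r| <= S * (2 * ratr rho).
    apply: (@le_trans _ _ (\sum_(i : I) (2 * ratr rho))); last first.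
      by rewrite sumr_const -[leLHS]mulr_natl.
    apply: ler_sum => i _; have := br' i; have := hq i; rewrite /= ffunE.
    by rewrite !ltr_norml ler_norml; lra.
  have := le_trans (GU _ _ Dr' Dr) (ler_wpM2l K0 sumle).
  move: rhoe; rewrite ltr_pdivlMr// => rhoe.
  by rewrite ler_norml; nra.
apply: countable_bigcupT_measurable => [|k]; first exact: countableP.
have [gk|ngk] := pselect (good k); last first.
  by rewrite (_ : [set _ | _] = set0)// -subset0 => r [].
have -> : [set r | box k r /\ good k] =
    D `&` \bigcap_(i in [set: I]) (D `&` U i @^-1` (ball (ratr (k.1 i) : R) (ratr k.2))).
  apply/seteqP; split => [r [[Dr br] _]|r [Dr br]].
    by split => // i _; split => //; rewrite /= -ball_normE /= distrC.
  split => //; split => // i; have [_] := br i Logic.I.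
  by rewrite /= -ball_normE /= distrC.
apply: measurableI => //; apply: fin_bigcap_measurable => [|i _].
  exact: finite_finset.
by apply: mU => //; exact: measurable_ball.
Qed.

(** * Geometric convergence and absorption *)

Section GeometricDecay.
Context {R : realType}.

Lemma ltr_half_exp (k e : R) : 0 < e -> exists n, k / 2 ^+ n < e.
Proof.
move=> e0; have [k0|k0] := leP k 0.
  by exists 0%N; rewrite expr0 divr1 (le_lt_trans k0).
have ke0 : 0 <= k / e by rewrite divr_ge0// ltW.
exists (Num.Def.archi_bound (k / e)).
rewrite ltr_pdivrMr ?exprn_gt0// mulrC -ltr_pdivrMr//.
apply: (lt_trans (archi_boundP ke0)).
by rewrite -natrX ltr_nat; exact: ltn_expl.
Qed.

Lemma norm_le_half_exp_eq0 (x k : R) : (forall n, `|x| <= k / 2 ^+ n) -> x = 0.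
Proof.
move=> xk; apply/eqP; rewrite -normr_eq0 eq_le normr_ge0 andbT leNgt.
by apply/negP => /(ltr_half_exp k)[n]; rewrite ltNge xk.
Qed.

(** With [w n = 2 * k / 2 ^+ n], the intervals of centre [u n] and radius [w n] are nested; the
    limit is the supremum of their left ends. *)
Lemma half_exp_limit (u : nat -> R) (k : R) : 0 <= k ->
  (forall n, `|u n.+1 - u n| <= k / 2 ^+ n) ->
  exists l, forall n, `|u n - l| <= 2 * k / 2 ^+ n.
Proof.
move=> k0 uk; pose w n := 2 * k / 2 ^+ n.
have wS n : w n = 2 * w n.+1 by rewrite /w exprS; field; rewrite expf_neq0.
have uw n : `|u n.+1 - u n| <= w n.+1.
  by apply: (le_trans (uk n)); rewrite /w exprS -mulf_div divff// mul1r.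
have w0 n : 0 <= w n by rewrite /w !mulr_ge0 ?invr_ge0 ?exprn_ge0.
have mono n p : `|u (n + p)%N - u n| <= w n - w (n + p)%N.
  elim: p => [|p IH]; first by rewrite addn0 !subrr normr0.
  rewrite addnS; have := uw (n + p)%N; have := wS (n + p)%N; move: IH.
  rewrite !ler_norml; lra.
have ab n p : u n - w n <= u p + w p.
  have [np|/ltnW pn] := leqP n p.
    have := mono n (p - n)%N; rewrite subnKC// ler_norml.
    have := w0 p; have := w0 n; lra.
  have := mono p (n - p)%N; rewrite subnKC// ler_norml.
  have := w0 p; have := w0 n; lra.
exists (sup (range (fun n => u n - w n))) => n.
have ub : has_ubound (range (fun n => u n - w n)).
  by exists (u 0%N + w 0%N) => _ [p _ <-].
have h1 : u n - w n <= sup (range (fun n => u n - w n)).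
  by apply: ub_le_sup => //; exists n.
have h2 : sup (range (fun n => u n - w n)) <= u n + w n.
  apply: ge_sup; first by exists (u 0%N - w 0%N), 0%N.
  by move=> _ [p _ <-].
by rewrite -/(w n) ler_norml; lra.
Qed.

(** The bound [B] makes the supremum [s] of [g] finite, and [step] applied to [s] itself gives
    [s <= a + s / 2]. *)
Lemma le_absorb_half (I : Type) (P : set I) (g : I -> R) (a B : R) :
  (forall i, P i -> g i <= B) ->
  (forall b, (forall i, P i -> g i <= b) -> forall i, P i -> g i <= a + b / 2) ->
  forall i, P i -> g i <= 2 * a.
Proof.
move=> gB step i Pi; have ub : has_ubound (g @` P) by exists B => _ [j Pj <-]; exact: gB.
set s := sup (g @` P).
have gs j : P j -> g j <= s by move=> Pj; apply: ub_le_sup => //; exists j.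
have ss : s <= a + s / 2.
  apply: ge_sup; first by exists (g i), i.
  by move=> _ [j Pj <-]; exact: (step s gs).
have := gs i Pi; lra.
Qed.

End GeometricDecay.

(** * Controlled trajectories as integral equations *)

Section ControlDefinitions.
Context {R : realType} {d m : nat}.
Implicit Types (s t : R).

Definition measurable_path (n : nat) s t (X : R -> 'rV[R]_n) :=
  forall i, measurable_fun `[s, t] (fun r => X r 0 i).

Definition controlled (A : set 'rV[R]_m)
    (f : R -> 'rV[R]_d -> 'rV[R]_m -> 'rV[R]_d) s t x al X :=
  admissible_control A s t al /\ trajectory f s t x al X.

Definition cost (c : R -> 'rV[R]_d -> 'rV[R]_m -> R) s t al X :=
  \int[lebesgue_measure]_(r in `[s, t]) c r (X r) (al r).

End ControlDefinitions.

Section ControlledPaths.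
Context {R : realType} {d m : nat} {L T : R} {A : set 'rV[R]_m}.
Context {c : R -> 'rV[R]_d -> 'rV[R]_m -> R}.
Context {f : R -> 'rV[R]_d -> 'rV[R]_m -> 'rV[R]_d} {q : 'rV[R]_d -> R}.
Hypothesis L0 : 0 <= L.
Hypothesis A1 : assumption_A1 L T A c f q.
Local Notation mu := (@lebesgue_measure R).
Implicit Types (s t u r : R) (x y : 'rV[R]_d) (a : 'rV[R]_m).
Implicit Types (al : R -> 'rV[R]_m) (X Y : R -> 'rV[R]_d).

Lemma cost_bound r x a : r \in `[0, T] -> A a -> `|c r x a| <= L.
Proof. by move=> r0T Aa; have [/(_ r x a r0T Aa)[]] := A1. Qed.

Lemma drift_bound r x a i : r \in `[0, T] -> A a -> `|f r x a 0 i| <= L.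
Proof.
move=> r0T Aa; have [/(_ r x a r0T Aa)[_]] := A1.
by move=> + _; exact/le_trans/coord_le_enorm.
Qed.

Lemma cost_lip r r' x x' a a' : r \in `[0, T] -> r' \in `[0, T] -> A a -> A a' ->
  `|c r x a - c r' x' a'| <= L * (`|r - r'| + enorm (x - x') + enorm (a - a')).
Proof. by move=> rT rT' Aa Aa'; have [_ [_ [/(_ r r' x x' a a' rT rT' Aa Aa')[]]]] := A1. Qed.

Lemma drift_lip r r' x x' a a' : r \in `[0, T] -> r' \in `[0, T] -> A a -> A a' ->
  enorm (f r x a - f r' x' a') <=
  L * (`|r - r'| + enorm (x - x') + enorm (a - a')).
Proof. by move=> rT rT' Aa Aa'; have [_ [_ [/(_ r r' x x' a a' rT rT' Aa Aa')[]]]] := A1. Qed.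

Lemma drift_coord_lip i r r' x x' a a' :
  r \in `[0, T] -> r' \in `[0, T] -> A a -> A a' ->
  `|f r x a 0 i - f r' x' a' 0 i| <=
  L * (`|r - r'| + enorm (x - x') + enorm (a - a')).
Proof.
move=> rT rT' Aa Aa'; apply: (le_trans _ (drift_lip x x' rT rT' Aa Aa')).
by have := coord_le_enorm (f r x a - f r' x' a') i; rewrite !mxE.
Qed.

Lemma terminal_bound x : `|q x| <= L.
Proof. by have [_ [/(_ x)]] := A1. Qed.

Lemma terminal_lip x y : `|q x - q y| <= L * enorm (x - y).
Proof. by have [_ [_ [_ /(_ x y)]]] := A1. Qed.

Lemma subitv s t r : 0 <= s -> t <= T -> r \in `[s, t] -> r \in `[0, T].
Proof.
move=> s0 tT; rewrite !in_itv/= => /andP[sr rt].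
by rewrite (le_trans s0 sr) (le_trans rt tT).
Qed.

(** The control is merely measurable, so measurability comes from the Lipschitz dependence of [F] on
    finitely many measurable scalar functions. *)
Lemma bounded_measurable_comp (F : R -> 'rV[R]_d -> 'rV[R]_m -> R) s t al X :
  0 <= s -> t <= T ->
  (forall r x a, r \in `[0, T] -> A a -> `|F r x a| <= L) ->
  (forall r r' x x' a a', r \in `[0, T] -> r' \in `[0, T] -> A a -> A a' ->
    `|F r x a - F r' x' a'| <= L * (`|r - r'| + enorm (x - x') + enorm (a - a'))) ->
  admissible_control A s t al -> measurable_path s t X ->
  bounded_measurable s t (fun r => F r (X r) (al r)).
Proof.
move=> s0 tT FL Flip [mal Aal] mX; split; last first.
  by exists L => r rst; apply: FL; [exact: subitv rst|exact: Aal].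
(* The scalar functions are the time, the coordinates of the path and the coordinates of the
   control. *)
pose U (i : unit + ('I_d + 'I_m)) (r : R) : R :=
  match i with inl _ => r | inr (inl j) => X r 0 j | inr (inr j) => al r 0 j end.
apply: (@measurable_fun_lipschitz R _ _ U _ L) => //.
  case=> [[]|[j|j]]; [exact: measurable_id|exact: mX|exact: mal].
move=> r r' rst rst'.
apply: (le_trans (Flip _ _ _ _ _ _ _ _ (Aal r rst) (Aal r' rst'))).
- exact: subitv rst.
- exact: subitv rst'.
rewrite !big_sumType/= (big_pred1 tt)/=; last by case.
apply: ler_wpM2l => //; rewrite -addrA lerD2l; apply: lerD.
  by apply: (le_trans (enorm_le_l1norm _)); apply: ler_sum => j _; rewrite !mxE.
by apply: (le_trans (enorm_le_l1norm _)); apply: ler_sum => j _; rewrite !mxE.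
Qed.

Section OnInterval.
Variables (s t : R) (al : R -> 'rV[R]_m) (X : R -> 'rV[R]_d).
Hypotheses (s0 : 0 <= s) (tT : t <= T).
Hypotheses (Aal : admissible_control A s t al) (mX : measurable_path s t X).

Lemma bounded_measurable_cost : bounded_measurable s t (fun r => c r (X r) (al r)).
Proof.
by apply: bounded_measurable_comp => //; [exact: cost_bound | exact: cost_lip].
Qed.

Lemma bounded_measurable_drift i :
  bounded_measurable s t (fun r => f r (X r) (al r) 0 i).
Proof.
apply: (bounded_measurable_comp (F := fun r x a => f r x a 0 i)) => //.
- by move=> *; exact: drift_bound.
- by move=> *; exact: drift_coord_lip.
Qed.

End OnInterval.

Lemma lip_measurable s t (g : R -> R) :
  (forall r r', r \in `[s, t] -> r' \in `[s, t] -> `|g r - g r'| <= L * `|r - r'|) ->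
  measurable_fun `[s, t] g.
Proof.
move=> glip.
apply: (@measurable_fun_lipschitz R unit _ (fun _ => id) _ L) => // r r' rst rst'.
by rewrite (big_pred1 tt)/=; [exact: glip|case].
Qed.

Lemma Rintegral_itv_lip s t (g : R -> R) r r' :
  bounded_measurable s t g -> (forall r, r \in `[s, t] -> `|g r| <= L) ->
  r \in `[s, t] -> r' \in `[s, t] ->
  `|\int[mu]_(z in `[s, r]) g z - \int[mu]_(z in `[s, r']) g z| <= L * `|r - r'|.
Proof.
move=> bg gL; wlog rr' : r r' / r' <= r.
  move=> H rst rst'; have [rr'|/ltW rr'] := leP r' r; first exact: H.
  by rewrite distrC (distrC r); exact: H.
rewrite !in_itv/= => /andP[sr rt] /andP[sr' rt'].
rewrite (Rintegral_concat sr' rr'); last exact: bounded_measurableS bg.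
rewrite addrAC subrr add0r (ger0_norm (_ : 0 <= r - r')) ?subr_ge0//.
apply: norm_Rintegral_itv => // [|z]; first exact: bounded_measurableS bg.
rewrite in_itv/= => /andP[? ?]; apply: gL; rewrite in_itv/=.
by apply/andP; split; [exact: le_trans sr' _|exact: le_trans rt].
Qed.

(** Continuity may be weakened to measurability, because the integral of a bounded drift is
    Lipschitz in time. This spares a continuity argument when paths are glued or obtained as
    limits. *)
Lemma trajectoryP s t x al X : 0 <= s -> s <= t -> t <= T ->
  admissible_control A s t al ->
  trajectory f s t x al X <->
  (measurable_path s t X /\ forall r, r \in `[s, t] -> forall i,
   X r 0 i = x 0 i + \int[mu]_(z in `[s, r]) f z (X z) (al z) 0 i).
Proof.
move=> s0 st tT Aal; split.
  move=> [cX [Xs eqX]]; have mX : measurable_path s t X.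
    move=> i; apply: subspace_continuous_measurable_fun => // r.
    apply: (@continuous_comp (subspace `[s, t]) _ _ X (fun M : 'rV[R]_d => M 0 i)).
      exact: cX.
    exact: coord_continuous.
  split=> // r rst i; apply: EFin_inj; rewrite eqX// EFinD EFin_Rintegral//.
  apply: bounded_measurableS (bounded_measurable_drift s0 tT Aal mX i) => //.
  by move: rst; rewrite in_itv/= => /andP[].
move=> [mX eqX].
have bX := bounded_measurable_drift s0 tT Aal mX.
have Xs : X s = x.
  apply/rowP => i; rewrite eqX ?in_itv/= ?lexx// Rintegral_point addr0//.
have lipX r r' i : r \in `[s, t] -> r' \in `[s, t] ->
    `|X r 0 i - X r' 0 i| <= L * `|r - r'|.
  move=> rst rst'; rewrite !eqX// opprD addrACA subrr add0r.
  apply: Rintegral_itv_lip rst rst' => // z zst.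
  by apply: drift_bound; [exact: subitv zst|exact: Aal.2].
split; last split => //.
  apply/subspace_continuousP => r rst; apply/cvg_ballP => e e0.
  rewrite near_withinE; near=> r' => r'st; split => // i j.
  rewrite ord1 /ball/= /ball_/=; apply: (le_lt_trans (lipX _ _ _ rst r'st)).
  (* [L + 1] replaces [L] so that the radius [e / (L + 1)] makes sense even for [L = 0]. *)
  apply: (@le_lt_trans _ _ ((L + 1) * `|r - r'|)).
    by apply: ler_wpM2r => //; rewrite lerDl.
  rewrite -ltr_pdivlMl ?ltr_wpDl// mulrC.
  near: r'; apply: (nbhsx_ballx r (e / (L + 1))).
  by rewrite divr_gt0// ltr_wpDl.
move=> r rst i; rewrite eqX// EFinD EFin_Rintegral//.
apply: bounded_measurableS (bX i) => //.
by move: rst; rewrite in_itv/= => /andP[].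
Unshelve. all: by end_near. Qed.

End ControlledPaths.

(** * Restriction, concatenation and local existence of trajectories *)

Section Flow.
Context {R : realType} {d m : nat} {L T : R} {A : set 'rV[R]_m}.
Context {c : R -> 'rV[R]_d -> 'rV[R]_m -> R}.
Context {f : R -> 'rV[R]_d -> 'rV[R]_m -> 'rV[R]_d} {q : 'rV[R]_d -> R}.
Hypothesis L0 : 0 <= L.
Hypothesis A1 : assumption_A1 L T A c f q.
Local Notation mu := (@lebesgue_measure R).
Implicit Types (s t u r : R) (x y : 'rV[R]_d) (a : 'rV[R]_m).
Implicit Types (al : R -> 'rV[R]_m) (X Y : R -> 'rV[R]_d).

Lemma admissibleS s t s' t' al : s <= s' -> t' <= t ->
  admissible_control A s t al -> admissible_control A s' t' al.
Proof.
move=> ss' t't [mal Aal]; split=> [j|r].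
  apply: measurable_funS (mal j) => // r /=; rewrite !in_itv/= => /andP[? ?].
  by apply/andP; split; [exact: le_trans ss' _|exact: le_trans t't].
rewrite !in_itv/= => /andP[? ?]; apply: Aal; rewrite in_itv/=.
by apply/andP; split; [exact: le_trans ss' _|exact: le_trans t't].
Qed.

Lemma measurable_pathS s t s' t' X : s <= s' -> t' <= t ->
  measurable_path s t X -> measurable_path s' t' X.
Proof.
move=> ss' t't mX i; apply: measurable_funS (mX i) => // r /=.
rewrite !in_itv/= => /andP[? ?].
by apply/andP; split; [exact: le_trans ss' _|exact: le_trans t't].
Qed.

Lemma controlled_path s t x al X : 0 <= s -> s <= t -> t <= T ->
  controlled A f s t x al X -> measurable_path s t X.
Proof. by move=> s0 st tT [Aal /(trajectoryP L0 A1 _ _ s0 st tT Aal)[]]. Qed.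

Lemma controlled_eq s t x al X : 0 <= s -> s <= t -> t <= T ->
  controlled A f s t x al X -> forall r i, r \in `[s, t] ->
  X r 0 i = x 0 i + \int[mu]_(z in `[s, r]) f z (X z) (al z) 0 i.
Proof.
by move=> s0 st tT [Aal /(trajectoryP L0 A1 _ _ s0 st tT Aal)[_ +]] r i rst; exact.
Qed.

Lemma controlled_start s t x al X : controlled A f s t x al X -> X s = x.
Proof. by move=> [_ [_ []]]. Qed.

Lemma controlled_speed s t x al X : 0 <= s -> s <= t -> t <= T ->
  controlled A f s t x al X -> forall r i, r \in `[s, t] ->
  `|X r 0 i - x 0 i| <= L * (t - s).
Proof.
move=> s0 st tT cX r i rst; rewrite (controlled_eq s0 st tT cX)// addrAC subrr add0r.
have [sr rt] : s <= r /\ r <= t by move: rst; rewrite in_itv/= => /andP[].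
have mX := controlled_path s0 st tT cX.
apply: (@le_trans _ _ (L * (r - s))); last by apply: ler_wpM2l => //; rewrite lerD2r.
apply: norm_Rintegral_itv => // [|z zsr].
  by apply: bounded_measurableS (bounded_measurable_drift L0 A1 s0 tT cX.1 mX i).
have zst : z \in `[s, t].
  by move: zsr; rewrite !in_itv/= => /andP[-> /= zr]; exact: le_trans rt.
by apply: (drift_bound A1); [exact: subitv zst|exact: cX.1.2].
Qed.

Lemma controlled_restrict s u t x al X : 0 <= s -> s <= u -> u <= t -> t <= T ->
  controlled A f s t x al X ->
  controlled A f s u x al X /\ controlled A f u t (X u) al X.
Proof.
move=> s0 su ut tT cX; have st := le_trans su ut.
have mX := controlled_path s0 st tT cX.
have eX := controlled_eq s0 st tT cX.
have bX := bounded_measurable_drift L0 A1 s0 tT cX.1 mX.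
have A1' : admissible_control A s u al by exact: admissibleS cX.1.
have A2' : admissible_control A u t al by exact: admissibleS cX.1.
split; split => //.
  apply/(trajectoryP L0 A1 _ _ s0 su (le_trans ut tT) A1'); split.
    exact: measurable_pathS mX.
  move=> r; rewrite in_itv/= => /andP[sr ru] i; apply: eX.
  by rewrite in_itv/= sr (le_trans ru ut).
apply/(trajectoryP L0 A1 _ _ (le_trans s0 su) ut tT A2'); split.
  exact: measurable_pathS mX.
move=> r; rewrite in_itv/= => /andP[ur rt] i.
rewrite !eX ?in_itv/= ?su ?ut ?(le_trans su ur)// -addrA; congr (_ + _).
by apply: Rintegral_concat => //; exact: bounded_measurableS (bX i).
Qed.

Lemma cost_concat s u t x al X : 0 <= s -> s <= u -> u <= t -> t <= T ->
  controlled A f s t x al X -> cost c s t al X = cost c s u al X + cost c u t al X.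
Proof.
move=> s0 su ut tT cX; have st := le_trans su ut.
apply: Rintegral_concat => //.
exact: (bounded_measurable_cost L0 A1 s0 tT cX.1 (controlled_path s0 st tT cX)).
Qed.

(** A single point is negligible; this handles the junction time of two glued controls. *)
Lemma eq_Rintegral_left_open s t (g g' : R -> R) :
  bounded_measurable s t g -> bounded_measurable s t g' ->
  (forall r, r \in `]s, t] -> g r = g' r) ->
  \int[mu]_(r in `[s, t]) g r = \int[mu]_(r in `[s, t]) g' r.
Proof.
move=> bg bg' gg'.
have sub : `]s, t]%classic `<=` `[s, t]%classic.
  by move=> r /=; rewrite !in_itv/= => /andP[/ltW-> ->].
rewrite -!Rintegral_itv_obnd_cbnd; last 2 first.
- by apply: integrableS (bounded_measurable_integrable bg').
- by apply: integrableS (bounded_measurable_integrable bg).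
by apply: eq_Rintegral => r; rewrite inE/=; exact: gg'.
Qed.

Lemma measurable_path_if n s u t (X Y : R -> 'rV[R]_n) : s <= u -> u <= t ->
  measurable_path s u X -> measurable_path u t Y ->
  measurable_path s t (fun r => if r <= u then X r else Y r).
Proof.
move=> su ut mX mY i.
have -> : `[s, t]%classic = `[s, u]%classic `|` `]u, t]%classic.
  apply/seteqP; split => r /=; rewrite !in_itv/=.
    by move=> /andP[-> ->] /=; rewrite andbT; case: (leP r u); [left|right].
  move=> [/andP[-> ru]|/andP[ur ->]]; first by rewrite (le_trans ru ut).
  by rewrite (le_trans su (ltW ur)).
apply/measurable_funU => //; split.
  apply: eq_measurable_fun (mX i) => r; rewrite inE/= in_itv/= => /andP[_ ->] //.
have sub : `]u, t]%classic `<=` `[u, t]%classic.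
  by move=> r /=; rewrite !in_itv/= => /andP[/ltW-> ->].
apply: eq_measurable_fun (measurable_funS _ sub (mY i)) => // r.
by rewrite inE/= in_itv/= => /andP[ur _]; rewrite leNgt ur.
Qed.

Lemma controlled_concat s u t x al X al' X' :
  0 <= s -> s <= u -> u <= t -> t <= T ->
  controlled A f s u x al X -> controlled A f u t (X u) al' X' ->
  exists al2 X2, [/\ controlled A f s t x al2 X2, X2 t = X' t &
    cost c s t al2 X2 = cost c s u al X + cost c u t al' X'].
Proof.
move=> s0 su ut tT cX cX'; have st := le_trans su ut.
have uT := le_trans ut tT; have u0 := le_trans s0 su.
have mX := controlled_path s0 su uT cX; have mX' := controlled_path u0 ut tT cX'.
pose al2 r := if r <= u then al r else al' r.
pose X2 r := if r <= u then X r else X' r.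
have mX2 : measurable_path s t X2 by exact: measurable_path_if.
have Aal2 : admissible_control A s t al2.
  split; first by exact: (measurable_path_if su ut cX.1.1 cX'.1.1).
  move=> r; rewrite in_itv/= /al2 => /andP[sr rt]; case: leP => ru.
    by apply: cX.1.2; rewrite in_itv/= sr.
  by apply: cX'.1.2; rewrite in_itv/= (ltW ru).
have bf2 := bounded_measurable_drift L0 A1 s0 tT Aal2 mX2.
have bf' := bounded_measurable_drift L0 A1 u0 tT cX'.1 mX'.
have bc2 := bounded_measurable_cost L0 A1 s0 tT Aal2 mX2.
have bc' := bounded_measurable_cost L0 A1 u0 tT cX'.1 mX'.
have E1 (F : R -> 'rV[R]_d -> 'rV[R]_m -> R) r : r <= u ->
    \int[mu]_(z in `[s, r]) F z (X2 z) (al2 z) = \int[mu]_(z in `[s, r]) F z (X z) (al z).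
  move=> ru; apply: eq_Rintegral => z; rewrite inE/= in_itv/= => /andP[_ zr].
  by rewrite /X2 /al2 (le_trans zr ru).
(* On [[u, r]] the glued data are those of the second piece except at [u], where they are those of
   the first. *)
have E2 (F : R -> 'rV[R]_d -> 'rV[R]_m -> R) r : r <= t ->
    bounded_measurable s t (fun z => F z (X2 z) (al2 z)) ->
    bounded_measurable u t (fun z => F z (X' z) (al' z)) ->
    \int[mu]_(z in `[u, r]) F z (X2 z) (al2 z) = \int[mu]_(z in `[u, r]) F z (X' z) (al' z).
  move=> rt b2 b'; apply: eq_Rintegral_left_open.
  - exact: bounded_measurableS b2.
  - exact: bounded_measurableS b'.
  - by move=> z; rewrite in_itv/= => /andP[uz _]; rewrite /X2 /al2 leNgt uz.
exists al2, X2; split; last first.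
- rewrite /cost (Rintegral_concat su ut)//; congr (_ + _); first exact: E1.
  exact: E2.
- rewrite /X2; case: leP => // tu.
  have -> : t = u by apply/eqP; rewrite eq_le tu ut.
  by rewrite (controlled_start cX').
split => //; apply/(trajectoryP L0 A1 _ _ s0 st tT Aal2); split => // r.
rewrite in_itv/= => /andP[sr rt] i; have [ru|/ltW ur] := leP r u.
  rewrite (E1 (fun z x a => f z x a 0 i))// /X2 ru.
  by rewrite (controlled_eq s0 su uT cX)// in_itv/= sr.
rewrite (Rintegral_concat su ur); last exact: bounded_measurableS (bf2 i).
rewrite (E1 (fun z x a => f z x a 0 i))// (E2 (fun z x a => f z x a 0 i))// addrA.
rewrite -(controlled_eq s0 su uT cX) ?in_itv/= ?su ?lexx//.
rewrite -(controlled_eq u0 ut tT cX') ?in_itv/= ?ur// /X2.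
case: leP => // ru; have -> : r = u by apply/eqP; rewrite eq_le ru ur.
by rewrite (controlled_start cX').
Qed.

(** Picard iteration: on an interval this short, the integral map [Phi] halves the uniform l1
    distance between measurable paths. *)
Lemma picard s t x al : 0 <= s -> s <= t -> t <= T -> d%:R * L * (t - s) <= 2^-1 ->
  admissible_control A s t al -> exists X, controlled A f s t x al X.
Proof.
move=> s0 st tT dLts Aal.
pose Phi X r := \row_i (x 0 i + \int[mu]_(z in `[s, r]) f z (X z) (al z) 0 i) : 'rV[R]_d.
pose Xn n := iter n Phi (fun=> x).
have fL X z i : z \in `[s, t] -> `|f z (X z) (al z) 0 i| <= L.
  by move=> zst; apply: (drift_bound A1); [exact: subitv zst|exact: Aal.2].
have PhiL X r r' i : measurable_path s t X -> r \in `[s, t] -> r' \in `[s, t] ->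
    `|Phi X r 0 i - Phi X r' 0 i| <= L * `|r - r'|.
  move=> mX rst rst'; rewrite !mxE opprD addrACA subrr add0r.
  apply: Rintegral_itv_lip rst rst' => //; last by move=> z; exact: fL.
  exact: (bounded_measurable_drift L0 A1 s0 tT Aal mX i).
have mXn n : measurable_path s t (Xn n).
  elim: n => [|n IH] i /=; first exact: measurable_cst.
  by apply: (lip_measurable L0) => r r' rst rst'; exact: PhiL.
have contr X Y k : measurable_path s t X -> measurable_path s t Y ->
    (forall r, r \in `[s, t] -> l1norm (X r - Y r) <= k) ->
    forall r i, r \in `[s, t] -> `|Phi X r 0 i - Phi Y r 0 i| <= L * k * (t - s).
  move=> mX mY XYk r i; rewrite in_itv/= => /andP[sr rt].
  have k0 : 0 <= k.
    by apply: (le_trans _ (XYk s _)); [exact: l1norm_ge0|rewrite in_itv/= lexx].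
  rewrite !mxE opprD addrACA subrr add0r.
  apply: (@le_trans _ _ (L * k * (r - s))); last first.
    by apply: ler_wpM2l; [exact: mulr_ge0|rewrite lerD2r].
  apply: norm_RintegralB_itv => // [||z].
  - exact: bounded_measurableS (bounded_measurable_drift L0 A1 s0 tT Aal mX i).
  - exact: bounded_measurableS (bounded_measurable_drift L0 A1 s0 tT Aal mY i).
  rewrite in_itv/= => /andP[sz zr].
  have zst : z \in `[s, t] by rewrite in_itv/= sz (le_trans zr rt).
  have zT := subitv s0 tT zst; have Aa := Aal.2 z zst.
  apply: (le_trans (drift_coord_lip A1 i _ _ zT zT Aa Aa)).
  rewrite !subrr normr0 enorm0 add0r addr0; apply: ler_wpM2l => //.
  exact: le_trans (enorm_le_l1norm _) (XYk z zst).
have l1contr X Y k : measurable_path s t X -> measurable_path s t Y -> 0 <= k ->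
    (forall r, r \in `[s, t] -> l1norm (X r - Y r) <= k) ->
    forall r, r \in `[s, t] -> l1norm (Phi X r - Phi Y r) <= k / 2.
  move=> mX mY k0 XYk r rst; apply: (@le_trans _ _ (d%:R * (L * k * (t - s)))).
    apply: l1norm_le_cst => i; have := contr X Y k mX mY XYk r i rst.
    by rewrite !mxE.
  by have := ler_wpM2l k0 dLts; lra.
have XnS n r : r \in `[s, t] -> l1norm (Xn n.+1 r - Xn n r) <= 1 / 2 ^+ n.
  elim: n r => [|n IH] r rst.
    rewrite expr0 divr1; apply: (@le_trans _ _ (d%:R * (L * (t - s)))); last by lra.
    apply: l1norm_le_cst => i; rewrite !mxE addrAC subrr add0r.
    have [sr rt] : s <= r /\ r <= t by move: rst; rewrite in_itv/= => /andP[].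
    apply: (@le_trans _ _ (L * (r - s))); last by apply: ler_wpM2l => //; rewrite lerD2r.
    apply: norm_Rintegral_itv => // [|z].
      exact: bounded_measurableS (bounded_measurable_drift L0 A1 s0 tT Aal (mXn 0%N) i).
    rewrite in_itv/= => /andP[sz zr].
    by apply: (fL (Xn 0%N)); rewrite in_itv/= sz (le_trans zr rt).
  have -> : 1 / 2 ^+ n.+1 = 1 / 2 ^+ n / 2 :> R by rewrite exprSr invfM !mulrA.
  have e0 : 0 <= 1 / 2 ^+ n :> R by rewrite divr_ge0// exprn_ge0.
  exact: (l1contr (Xn n.+1) (Xn n) _ (mXn _) (mXn _) e0 IH).
have coordXn n r i : r \in `[s, t] -> `|Xn n.+1 r 0 i - Xn n r 0 i| <= 1 / 2 ^+ n.
  move=> /(XnS n); apply: le_trans; rewrite /l1norm (bigD1 i)//= !mxE lerDl.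
  exact: sumr_ge0.
(* The limit is taken coordinatewise at each time; outside [[s, t]] the path is set to zero. *)
have /choice[X hX] : forall r, exists y : 'rV[R]_d, r \in `[s, t] ->
    forall n i, `|Xn n r 0 i - y 0 i| <= 2 / 2 ^+ n.
  move=> r; have [rst|nrst] := boolP (r \in `[s, t]); last by exists 0.
  have /choice[y hy] : forall i, exists l, forall n, `|Xn n r 0 i - l| <= 2 * 1 / 2 ^+ n.
    by move=> i; apply: (@half_exp_limit R (fun n => Xn n r 0 i)) => // n; exact: coordXn.
  by exists (\row_i y i) => _ n i; have := hy i n; rewrite mxE mulr1.
have mX : measurable_path s t X.
  (* All iterates after the first path have the same Lipschitz constant [L]. If the limit violated
     it at [r], [r'], an iterate close enough to the limit at both times would violate it too. *)
  move=> i; apply: (lip_measurable L0) => r r' rst rst'; rewrite leNgt; apply/negP => lt.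
  have [n] := @ltr_half_exp R 4 (`|X r 0 i - X r' 0 i| - L * `|r - r'|) ltac:(lra).
  have := hX r rst n.+1 i; have := hX r' rst' n.+1 i.
  have := PhiL (Xn n) r r' i (mXn n) rst rst'; rewrite -/(Xn n.+1).
  have -> : 2 / 2 ^+ n.+1 = 1 / 2 ^+ n :> R by rewrite exprS invfM mulrA divff.
  have e0 : 0 <= 1 / 2 ^+ n :> R by rewrite divr_ge0// exprn_ge0.
  have -> : 4 / 2 ^+ n = 4 * (1 / 2 ^+ n) :> R by rewrite mulrA mulr1.
  move: (1 / _) e0 => e e0 h1 h2 h3 h4; move: (X r 0 i) (X r' 0 i) lt h1 h2 h3 h4.
  move=> p p' lt; have [pp|pp] := leP p' p.
    rewrite (ger0_norm (_ : 0 <= p - p')) ?subr_ge0//.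
    rewrite (ger0_norm (_ : 0 <= p - p')) ?subr_ge0// in lt.
    by rewrite !ler_norml; lra.
  rewrite (ltr0_norm (_ : p - p' < 0)) ?subr_lt0//.
  by rewrite !ler_norml; lra.
exists X; split => //; apply/(trajectoryP L0 A1 _ _ s0 st tT Aal); split => // r rst i.
apply/eqP; rewrite -subr_eq0; apply/eqP.
(* [Phi (Xn n)] is the next iterate: it is within [1 / 2 ^+ n] of [X] by convergence and of [Phi X]
   by contraction. *)
apply: (@norm_le_half_exp_eq0 R _ 2) => n.
have h1 : `|Phi (Xn n) r 0 i - X r 0 i| <= 2 / 2 ^+ n.+1 := hX r rst n.+1 i.
have <- : Phi X r 0 i = x 0 i + \int[mu]_(z in `[s, r]) f z (X z) (al z) 0 i.
  by rewrite mxE.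
have h2 : `|Phi (Xn n) r 0 i - Phi X r 0 i| <= L * (d%:R * (2 / 2 ^+ n)) * (t - s).
  apply: contr => // z zst; apply: l1norm_le_cst => j; rewrite !mxE; exact: hX.
have e0 : 0 <= 1 / 2 ^+ n :> R by rewrite divr_ge0// exprn_ge0.
have E : 2 / 2 ^+ n.+1 = 1 / 2 ^+ n :> R by rewrite exprS invfM mulrA divff.
have E' : 2 / 2 ^+ n = 2 * (1 / 2 ^+ n) :> R by rewrite mulrA mulr1.
move: h1 h2; rewrite E E'.
move: (1 / 2 ^+ n) e0 => e e0 h1 h2.
have h3 : L * (d%:R * (2 * e)) * (t - s) <= e by have := ler_wpM2l e0 dLts; lra.
by move: h1 (le_trans h2 h3); rewrite !ler_norml; lra.
Qed.

End Flow.

(** * Dynamic programming and Lipschitz regularity of the value function *)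

Section ValueFunction.
Context {R : realType} {d m : nat} {L T : R} {A : set 'rV[R]_m}.
Context {c : R -> 'rV[R]_d -> 'rV[R]_m -> R}.
Context {f : R -> 'rV[R]_d -> 'rV[R]_m -> 'rV[R]_d} {q : 'rV[R]_d -> R}.
Hypothesis L0 : 0 <= L.
Hypothesis A1 : assumption_A1 L T A c f q.
Local Notation mu := (@lebesgue_measure R).
Implicit Types (s t u r : R) (x y : 'rV[R]_d) (a : 'rV[R]_m).
Implicit Types (al : R -> 'rV[R]_m) (X Y : R -> 'rV[R]_d).

Variable (a0 : 'rV[R]_m) (dl : R).
Hypotheses (Aa0 : A a0) (dl_gt0 : 0 < dl) (dl_le1 : dl <= 1).
Hypothesis dl_small : d%:R * L * dl <= 2^-1.
Local Notation v := (value_function T A c f q).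

Let dLdl s t : t - s <= dl -> d%:R * L * (t - s) <= 2^-1.
Proof. by move=> ts; apply: le_trans dl_small; apply: ler_wpM2l => //; exact: mulr_ge0. Qed.

Lemma admissible_cst s t a : A a -> admissible_control A s t (fun=> a).
Proof. by move=> Aa; split => // j; exact: measurable_cst. Qed.

(** Picard pieces with the constant control [a0], each of length at most [dl], are glued; [n] bounds
    the number of pieces. *)
Lemma controlled_exists s x : 0 <= s -> s <= T -> exists al X, controlled A f s T x al X.
Proof.
have [n] : exists n : nat, (T - s) <= n%:R * dl.
  have [sT|/ltW Ts] := leP (T - s) 0; first by exists 0%N; rewrite mul0r.
  exists (Num.Def.archi_bound ((T - s) / dl)); rewrite -ler_pdivrMr//.
  by apply/ltW/archi_boundP; rewrite divr_ge0// ltW.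
elim: n s x => [|n IH] s x.
  rewrite mul0r subr_le0 => Ts s0 sT; exists (fun=> a0).
  have sT' : T - s <= dl by rewrite (le_trans _ (ltW dl_gt0))// subr_le0.
  have [X cX] := picard L0 A1 x s0 sT (lexx T) (dLdl sT') (admissible_cst s T Aa0).
  by exists X.
move=> Tsn s0 sT; have [sdl|sdl] := leP (T - s) dl.
  exists (fun=> a0).
  have [X cX] := picard L0 A1 x s0 sT (lexx T) (dLdl sdl) (admissible_cst s T Aa0).
  by exists X.
have ss' : s <= s + dl by rewrite lerDl ltW.
have s'T : s + dl <= T by rewrite -lerBrDl ltW.
have e : s + dl - s <= dl by rewrite addrAC subrr add0r.
have [X cX] := picard L0 A1 x s0 ss' s'T (dLdl e) (admissible_cst s (s + dl) Aa0).
have [||al [Y cY]] := IH (s + dl) (X (s + dl)) _ _ s'T.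
- by move: Tsn; rewrite -natr1; lra.
- exact: le_trans ss'.
have [al2 [X2 [c2 _ _]]] := controlled_concat L0 A1 s0 ss' s'T (lexx T) cX cY.
by exists al2, X2.
Qed.

Lemma cost_norm s t x al X : 0 <= s -> s <= t -> t <= T ->
  controlled A f s t x al X -> `|cost c s t al X| <= L * (t - s).
Proof.
move=> s0 st tT cX; apply: norm_Rintegral_itv => // [|r rst].
  exact: (bounded_measurable_cost L0 A1 s0 tT cX.1 (controlled_path L0 A1 s0 st tT cX)).
by apply: (cost_bound A1); [exact: subitv rst|exact: cX.1.2].
Qed.

Lemma payoff_norm s x al X : 0 <= s -> s <= T -> controlled A f s T x al X ->
  `|cost c s T al X + q (X T)| <= L * T + L.
Proof.
move=> s0 sT cX; apply: (le_trans (ler_normD _ _)); apply: lerD; last first.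
  exact: terminal_bound A1 _.
apply: (le_trans (cost_norm s0 sT (lexx T) cX)); apply: ler_wpM2l => //.
by rewrite gerBl.
Qed.

(** Together with [controlled_exists], this makes the real [inf] in [value_function] a genuine
    infimum. *)
Lemma payoff_lbound s x : 0 <= s -> s <= T -> has_lbound
  [set J | exists (al : R -> 'rV[R]_m) (X : R -> 'rV[R]_d),
     admissible_control A s T al /\ trajectory f s T x al X /\
     J = Rintegral lebesgue_measure `[s, T] (fun r => c r (X r) (al r)) + q (X T)].
Proof.
move=> s0 sT; exists (- (L * T + L)) => _ [al [X [Aal [tX ->]]]].
by have := payoff_norm s0 sT (conj Aal tX); rewrite ler_norml => /andP[].
Qed.

Lemma value_le s x al X : 0 <= s -> s <= T -> controlled A f s T x al X ->
  v s x <= cost c s T al X + q (X T).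
Proof.
move=> s0 sT [Aal tX]; apply: ge_inf; first exact: payoff_lbound.
by exists al, X.
Qed.

Lemma value_near s x e : 0 <= s -> s <= T -> 0 < e ->
  exists al X, controlled A f s T x al X /\ cost c s T al X + q (X T) <= v s x + e.
Proof.
move=> s0 sT e0; have [|_ [al [X [Aal [tX ->]]]] lt] := inf_adherent
    (E := [set J | exists (al : R -> 'rV[R]_m) (X : R -> 'rV[R]_d),
     admissible_control A s T al /\ trajectory f s T x al X /\
     J = Rintegral lebesgue_measure `[s, T] (fun r => c r (X r) (al r)) + q (X T)]) e0.
  split; last exact: payoff_lbound.
  have [al [X [Aal tX]]] := controlled_exists x s0 sT.
  by exists (cost c s T al X + q (X T)), al, X.
by exists al, X; split; [split | exact: ltW].
Qed.

Lemma value_norm s x : 0 <= s -> s <= T -> `|v s x| <= L * T + L.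
Proof.
move=> s0 sT; have [al [X cX]] := controlled_exists x s0 sT.
have := le_trans (value_le s0 sT cX) (ler_norm _).
move=> /le_trans/(_ (payoff_norm s0 sT cX)) vle.
rewrite ler_norml vle andbT; apply: lb_le_inf.
  by exists (cost c s T al X + q (X T)), al, X; case: cX.
move=> _ [al' [X' [Aal [tX ->]]]].
by have := payoff_norm s0 sT (conj Aal tX); rewrite ler_norml => /andP[].
Qed.

Lemma value_terminal x : 0 <= T -> v T x = q x.
Proof.
move=> T0; have E al X : controlled A f T T x al X -> cost c T T al X + q (X T) = q x.
  by move=> cX; rewrite /cost Rintegral_point add0r (controlled_start cX).
have [al [X cX]] := controlled_exists x T0 (lexx T).
apply/eqP; rewrite eq_le -{1}(E _ _ cX) value_le//=.
apply: lb_le_inf.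
  by exists (cost c T T al X + q (X T)), al, X; case: cX.
by move=> _ [al' [X' [Aal [tX ->]]]]; rewrite -(E _ _ (conj Aal tX)).
Qed.

(** The given path is continued after [u] by an almost optimal one starting from [X u]. *)
Lemma value_dpp_le s u x al X : 0 <= s -> s <= u -> u <= T ->
  controlled A f s u x al X -> v s x <= cost c s u al X + v u (X u).
Proof.
move=> s0 su uT cX; apply/ler_addgt0Pr => e e0.
have [al' [X' [cX' le']]] := value_near (X u) (le_trans s0 su) uT e0.
have [al2 [X2 [c2 E1 E2]]] := controlled_concat L0 A1 s0 su uT (lexx T) cX cX'.
apply: (le_trans (value_le s0 (le_trans su uT) c2)).
by rewrite E1 E2 -!addrA lerD2l.
Qed.

(** An almost optimal path on [[s, T]] is cut at [u]; its tail is a competitor for the value at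
    [X u]. *)
Lemma value_dpp_ge s u x e : 0 <= s -> s <= u -> u <= T -> 0 < e ->
  exists al X, controlled A f s u x al X /\ cost c s u al X + v u (X u) <= v s x + e.
Proof.
move=> s0 su uT e0; have [al [X [cX le']]] := value_near x s0 (le_trans su uT) e0.
have [c1 c2] := controlled_restrict L0 A1 s0 su uT (lexx T) cX.
exists al, X; split => //; apply: le_trans le'.
rewrite (cost_concat L0 A1 s0 su uT (lexx T) cX) -addrA lerD2l.
exact: value_le (le_trans s0 su) uT c2.
Qed.

(** [dotv p (X u - x)] is the integral of [dotv p f] along the path, so the pointwise lower bound
    can be integrated. *)
Lemma controlled_integral_ge s u x al X (sigma G : R) (p : 'rV[R]_d) :
  0 <= s -> s <= u -> u <= T -> controlled A f s u x al X ->
  (forall r, r \in `[s, u] ->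
    G <= sigma * c r (X r) (al r) - dotv p (f r (X r) (al r))) ->
  G * (u - s) <= sigma * cost c s u al X - dotv p (X u - x).
Proof.
move=> s0 su uT cX GX; have mX := controlled_path L0 A1 s0 su uT cX.
have bc := bounded_measurable_cost L0 A1 s0 uT cX.1 mX.
have bf := bounded_measurable_drift L0 A1 s0 uT cX.1 mX.
have bpf i := bounded_measurableZ (- p 0 i) (bf i).
have bs := bounded_measurable_sum bpf.
have -> : sigma * cost c s u al X - dotv p (X u - x) = \int[mu]_(r in `[s, u])
    (sigma * c r (X r) (al r) + \sum_i - p 0 i * f r (X r) (al r) 0 i).
  rewrite Rintegral_itvD//; last exact: bounded_measurableZ.
  rewrite Rintegral_itvZ// Rintegral_itv_sum//; congr (_ + _).
  rewrite /dotv -sumrN; apply: eq_bigr => i _; rewrite Rintegral_itvZ// !mxE.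
  rewrite (controlled_eq L0 A1 s0 su uT cX) ?in_itv/= ?su ?lexx//.
  by rewrite addrAC subrr add0r mulNr.
apply: ge_Rintegral_itv => // [|r /GX].
  by apply: bounded_measurableD => //; exact: bounded_measurableZ.
move=> /le_trans; apply; rewrite lerD2l /dotv -sumrN; apply: ler_sum => i _.
by rewrite mulNr.
Qed.

(* Dynamic programming in the two directions: for [sigma = 1] the control is an
   almost optimal one, for [sigma = -1] it is the constant [a]. *)
Lemma value_step (sigma : R) s u x a (e : R) : sigma = 1 \/ sigma = -1 ->
  0 <= s -> s <= u -> u <= T -> u - s <= dl -> A a -> 0 < e ->
  exists (J : R) (D : 'rV[R]_d), [/\ sigma * (J + v u (x + D) - v s x) <= e,
    (forall i, `|D 0 i| <= L * (u - s)) &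
    forall (p : 'rV[R]_d) (G : R), (forall b r (z : 'rV[R]_d), A b -> sigma = 1 \/ b = a -> r \in `[s, u] ->
        (forall i, `|z 0 i - x 0 i| <= L * (u - s)) ->
        G <= sigma * c r z b - dotv p (f r z b)) ->
      G * (u - s) <= sigma * J - dotv p D].
Proof.
move=> sg s0 su uT usdl Aa e0.
have [al [X [cX hv hal]]] : exists al X, [/\ controlled A f s u x al X,
    sigma * (cost c s u al X + v u (X u) - v s x) <= e &
    forall r, sigma = 1 \/ al r = a].
  case: sg => ->.
    have [al [X [cX h]]] := value_dpp_ge x s0 su uT e0.
    by exists al, X; split => //; [rewrite mul1r lerBlDl|left].
  have [X cX] := picard L0 A1 x s0 su uT (dLdl usdl) (admissible_cst s u Aa).
  exists (fun=> a), X; split => //; last by right.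
  by have := value_dpp_le s0 su uT cX; lra.
exists (cost c s u al X), (X u - x); split.
- by rewrite (addrC x) subrK.
- move=> i; rewrite !mxE; apply: (controlled_speed L0 A1 s0 su uT cX).
  by rewrite in_itv/= su lexx.
- move=> p G hG; apply: controlled_integral_ge => // r rsu; apply: hG => //.
    exact: cX.1.2.
  by move=> i; exact: (controlled_speed L0 A1 s0 su uT cX).
Qed.

(** Over a time at most [dl], the integrated drift difference is at most half of any uniform bound
    on the gap, so absorption takes the place of Gronwall's inequality. *)
Lemma controlled_gap s u x y al X Y : 0 <= s -> s <= u -> u <= T -> u - s <= dl ->
  controlled A f s u x al X -> controlled A f s u y al Y ->
  forall r, r \in `[s, u] -> l1norm (X r - Y r) <= 2 * l1norm (x - y).
Proof.
move=> s0 su uT usdl cX cY.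
have mX := controlled_path L0 A1 s0 su uT cX; have mY := controlled_path L0 A1 s0 su uT cY.
have bX := bounded_measurable_drift L0 A1 s0 uT cX.1 mX.
have bY := bounded_measurable_drift L0 A1 s0 uT cY.1 mY.
apply: (@le_absorb_half R R [set r | r \in `[s, u]]
  (fun r => l1norm (X r - Y r)) _ (d%:R * (2 * L * (u - s)) + l1norm (x - y))).
  move=> r /= rsu.
  have -> : X r - Y r = ((X r - x) - (Y r - y)) + (x - y).
    by rewrite opprB !addrA; apply/rowP => i; rewrite !mxE; ring.
  apply: (le_trans (ler_l1normD _ _)); rewrite lerD2r; apply: l1norm_le_cst => i.
  have := controlled_speed L0 A1 s0 su uT cX i rsu.
  have := controlled_speed L0 A1 s0 su uT cY i rsu.
  by rewrite !mxE !ler_norml; lra.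
move=> b hb r /= rsu.
have b0 : 0 <= b by apply: le_trans (hb r rsu); exact: l1norm_ge0.
have [sr ru] : s <= r /\ r <= u by move: rsu; rewrite in_itv/= => /andP[].
pose E : 'rV[R]_d := \row_i (\int[mu]_(z in `[s, r]) f z (X z) (al z) 0 i -
                 \int[mu]_(z in `[s, r]) f z (Y z) (al z) 0 i).
have -> : X r - Y r = (x - y) + E.
  apply/rowP => i; rewrite !mxE (controlled_eq L0 A1 s0 su uT cX)//.
  by rewrite (controlled_eq L0 A1 s0 su uT cY)//; ring.
apply: (le_trans (ler_l1normD _ _)); rewrite lerD2l.
apply: (@le_trans _ _ (d%:R * (L * b * (u - s)))); last first.
  by have := ler_wpM2l b0 (dLdl usdl); lra.
apply: l1norm_le_cst => i; rewrite mxE.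
apply: (@le_trans _ _ (L * b * (r - s))); last first.
  by apply: ler_wpM2l; [exact: mulr_ge0|rewrite lerD2r].
apply: norm_RintegralB_itv => // [||z].
- exact: bounded_measurableS (bX i).
- exact: bounded_measurableS (bY i).
rewrite in_itv/= => /andP[sz zr].
have zsu : z \in `[s, u] by rewrite in_itv/= sz (le_trans zr ru).
have zT := subitv s0 uT zsu; have Aa := cX.1.2 z zsu.
apply: (le_trans (drift_coord_lip A1 i _ _ zT zT Aa Aa)).
rewrite !subrr normr0 enorm0 add0r addr0; apply: ler_wpM2l => //.
exact: le_trans (enorm_le_l1norm _) (hb z zsu).
Qed.

(* The constant solves K' = 2 (K + L) with K = L at time T. *)
Lemma value_lip_l1 n s x y : 0 <= s -> s <= T -> T - s <= n%:R * dl ->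
  v s x - v s y <= L * (3 * 2 ^+ n - 2) * l1norm (x - y).
Proof.
elim: n s x y => [|n IH] s x y s0 sT.
  rewrite mul0r subr_le0 => Ts; have -> : s = T by apply/eqP; rewrite eq_le sT Ts.
  rewrite !value_terminal ?(le_trans s0 sT)//; apply: (le_trans (ler_norm _)).
  apply: (le_trans (terminal_lip A1 x y)); rewrite expr0 mulr1.
  rewrite (_ : 3 - 2 = 1) ?mulr1; last by lra.
  by apply: ler_wpM2l => //; exact: enorm_le_l1norm.
move=> Tsn; set K := L * (3 * 2 ^+ n - 2) in IH *.
have K0 : 0 <= K.
  have : 1 <= 2 ^+ n :> R by apply: exprn_ege1; lra.
  by move=> ?; apply: mulr_ge0 => //; lra.
have KS : L * (3 * 2 ^+ n.+1 - 2) = 2 * (K + L) by rewrite /K exprS; ring.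
rewrite KS.
have [u [su uT usdl Tun]] : exists u, [/\ s <= u, u <= T, u - s <= dl & T - u <= n%:R * dl].
  have [sdl|sdl] := leP (T - s) dl.
    by exists T; split => //; rewrite subrr mulr_ge0// ltW.
  exists (s + dl); split; [by rewrite lerDl ltW|lra|lra|].
  by move: Tsn; rewrite -natr1; lra.
apply/ler_addgt0Pr => e e0.
(* A control almost optimal from [y] is also run from [x], so the two payoffs differ only through
   the gap between the paths. *)
have [al [Y [cY hY]]] := value_dpp_ge y s0 su uT e0.
have [X cX] := picard L0 A1 x s0 su uT (dLdl usdl) cY.1.
have gap := controlled_gap s0 su uT usdl cX cY.
have h1 := value_dpp_le s0 su uT cX.
have h2 := IH u (X u) (Y u) (le_trans s0 su) uT Tun.
have h3 : K * l1norm (X u - Y u) <= K * (2 * l1norm (x - y)).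
  by apply: ler_wpM2l => //; apply: gap; rewrite in_itv/= su lexx.
have h4 : cost c s u al X - cost c s u al Y <= L * (2 * l1norm (x - y)).
  apply: (le_trans (ler_norm _)).
  (* The factor [u - s] is dropped because [dl <= 1]. *)
  apply: (@le_trans _ _ (L * (2 * l1norm (x - y)) * (u - s))); last first.
    rewrite ler_piMr ?mulr_ge0 ?l1norm_ge0//; exact: le_trans dl_le1.
  apply: norm_RintegralB_itv => // [||r rsu].
  - exact: (bounded_measurable_cost L0 A1 s0 uT cX.1 (controlled_path L0 A1 s0 su uT cX)).
  - exact: (bounded_measurable_cost L0 A1 s0 uT cY.1 (controlled_path L0 A1 s0 su uT cY)).
  have rT := subitv s0 uT rsu; have Aa := cX.1.2 r rsu.
  apply: (le_trans (cost_lip A1 _ _ rT rT Aa Aa)).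
  rewrite !subrr normr0 enorm0 add0r addr0; apply: ler_wpM2l => //.
  exact: le_trans (enorm_le_l1norm _) (gap r rsu).
have -> : 2 * (K + L) * l1norm (x - y) =
  K * (2 * l1norm (x - y)) + L * (2 * l1norm (x - y)) by ring.
move: h1 h2 h3 h4 hY {IH gap}.
move: (K * l1norm _) (K * (2 * _)) (L * (2 * _)) (cost c s u al X) (cost c s u al Y).
move: (v s x) (v s y) (v u (X u)) (v u (Y u)) => *.
lra.
Qed.

Lemma value_lip n s x y : 0 <= s -> s <= T -> T - s <= n%:R * dl ->
  `|v s x - v s y| <= 3 * L * 2 ^+ n * d%:R * enorm (x - y).
Proof.
move=> s0 sT Tsn.
have le1 z w : v s z - v s w <= 3 * L * 2 ^+ n * d%:R * enorm (z - w).
  apply: (le_trans (value_lip_l1 z w s0 sT Tsn)).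
  rewrite -[leRHS]mulrA; apply: ler_pM; last exact: l1norm_le_enorm.
  - have : 1 <= 2 ^+ n :> R by apply: exprn_ege1; lra.
    by move=> ?; apply: mulr_ge0 => //; lra.
  - exact: l1norm_ge0.
  - by move: L0; lra.
rewrite ler_norml le1 andbT lerNl opprB enormB; exact: le1.
Qed.

End ValueFunction.

(* The two difference weights are nonnegative because |f_i| <= 2 N: this is
   where the discretisation is monotone. *)
Definition upwind (R : realType) (d m : nat) (N h : R)
    (c : R -> 'rV[R]_d -> 'rV[R]_m -> R) (f : R -> 'rV[R]_d -> 'rV[R]_m -> 'rV[R]_d)
    (a : 'rV[R]_m) (t : R) (y : 'rV[R]_d) (w : 'rV[R]_d -> R) : R :=
  c t y a + \sum_(i < d)
    ((f t y a 0 i / (2 * h) + N / h) * (w (y + h *: evec R i) - w y) +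
     (N / h - f t y a 0 i / (2 * h)) * (w (y - h *: evec R i) - w y)).

(** * The monotone scheme: mean value formula, time regularity and touching by quadratics *)

Section Semidiscrete.
Context {R : realType} {d m : nat} {N h L T : R} {A : set 'rV[R]_m}.
Context {c : R -> 'rV[R]_d -> 'rV[R]_m -> R}.
Context {f : R -> 'rV[R]_d -> 'rV[R]_m -> 'rV[R]_d} {q : 'rV[R]_d -> R}.
Context {alpha : R -> 'rV[R]_d -> 'rV[R]_d -> 'rV[R]_m}.
Context {alpha0 : R -> 'rV[R]_d -> 'rV[R]_m} {vh : R -> 'rV[R]_d -> R}.
Hypotheses (L0 : 0 <= L) (N0 : 0 <= N) (h0 : 0 < h).
Hypothesis A1 : assumption_A1 L T A c f q.
Hypothesis A2 : assumption_A2 L T A c f alpha alpha0.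
Hypothesis f_le : forall t x a, t \in `[0, T] -> A a -> enorm (f t x a) <= 2 * N.
Hypothesis vh_sol : semidiscrete_solution N h T A c f q vh.
Implicit Types (s t u r : R) (x y : 'rV[R]_d) (a b : 'rV[R]_m).

(** The infimum is attained at the minimizer supplied by [assumption_A2]. *)
Lemma Ham_alpha t x p : t \in `[0, T] ->
  Ham A c f t x p = c t x (alpha t x p) + dotv p (f t x (alpha t x p)).
Proof.
move=> tT; have [Aal min_al] := A2.1 t x p tT.
have lb : lbound [set c t x a + dotv p (f t x a) | a in A]
    (c t x (alpha t x p) + dotv p (f t x (alpha t x p))).
  move=> _ [a Aa <-]; have [->//|/eqP ne] := eqVneq a (alpha t x p).
  exact/ltW/min_al.
apply/eqP; rewrite eq_le; apply/andP; split.
  by apply: ge_inf; [eexists; exact: lb|exists (alpha t x p)].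
by apply: lb_le_inf => //; eexists; exists (alpha t x p).
Qed.

Lemma upwindE a t y (w : 'rV[R]_d -> R) :
  c t y a + dotv (gradh h w y) (f t y a) + N * h * laplh h w y = upwind N h c f a t y w.
Proof.
rewrite /upwind /dotv /laplh mulr_sumr -addrA -big_split/=; congr (_ + _).
by apply: eq_bigr => i _; rewrite mxE; field; rewrite gt_eqF.
Qed.

Lemma weight_ge0 a t y i : t \in `[0, T] -> A a ->
  0 <= f t y a 0 i / (2 * h) + N / h /\ 0 <= N / h - f t y a 0 i / (2 * h).
Proof.
move=> tT Aa; have := le_trans (coord_le_enorm _ i) (f_le y tT Aa).
rewrite ler_norml => /andP[fN1 fN2]; have h2 : 0 <= 2 * h by rewrite mulr_ge0// ltW.
have -> : f t y a 0 i / (2 * h) + N / h = (f t y a 0 i + 2 * N) / (2 * h).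
  by field; rewrite gt_eqF.
have -> : N / h - f t y a 0 i / (2 * h) = (2 * N - f t y a 0 i) / (2 * h).
  by field; rewrite gt_eqF.
by split; apply: divr_ge0 => //; move: fN1 fN2; lra.
Qed.

(** The mean value theorem evaluates the equation at one intermediate time [xi], and [a] is the
    minimizer there. Its minimality passes to [upwind] because the discrete Laplacian does not
    involve the control. *)
Lemma semidiscrete_mvt s u y : 0 <= s -> s < u -> u <= T ->
  exists xi a, [/\ xi \in `]s, u[, A a,
    vh s y - vh u y = upwind N h c f a xi y (vh xi) * (u - s) &
    forall b, A b -> upwind N h c f a xi y (vh xi) <= upwind N h c f b xi y (vh xi)].
Proof.
move=> s0 su uT; have [_ [cvh [dvh _]]] := vh_sol.
have cont : {within `[s, u], continuous (fun r => vh r y)}.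
  apply: continuous_subspaceW (cvh y) => r /=; rewrite !in_itv/= => /andP[sr ru].
  by rewrite (le_trans s0 sr) (le_trans ru uT).
pose df r := - Ham A c f r y (gradh h (vh r) y) - N * h * laplh h (vh r) y.
have der r : r \in `]s, u[ -> is_derive r 1 (fun r => vh r y) (df r).
  rewrite in_itv/= => /andP[sr ru]; apply: dvh.
  by rewrite in_itv/= (le_lt_trans s0 sr) (lt_le_trans ru uT).
have [xi xisu E] := @MVT R (fun r => vh r y) df s u su der cont.
have xiT : xi \in `[0, T].
  move: xisu; rewrite !in_itv/= => /andP[sr ru].
  by rewrite (le_trans s0 (ltW sr)) (le_trans (ltW ru) uT).
set p := gradh h (vh xi) y.
have [Aal min_al] := A2.1 xi y p xiT.
exists xi, (alpha xi y p); split => //.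
  by rewrite -upwindE -Ham_alpha// -opprB E /df; ring.
move=> b Ab; rewrite -!upwindE lerD2r.
have [->//|/eqP ne] := eqVneq b (alpha xi y p).
exact/ltW/min_al.
Qed.

(** The constant depends on [h] and on the bound of [vh], hence is not universal. It only enters
    errors that are quadratic in the time step, which vanish under subdivision. *)
Lemma semidiscrete_time_lip : exists K, 0 <= K /\
  forall s u y, s \in `[0, T] -> u \in `[0, T] -> `|vh s y - vh u y| <= K * `|s - u|.
Proof.
have [[M vhM] _] := vh_sol.
have [T0|T0] := leP 0 T; last first.
  exists 0; split => // s u y; rewrite in_itv/= => /andP[s0 sT].
  by have := le_lt_trans (le_trans s0 sT) T0; rewrite ltxx.
have M0 : 0 <= M.
  by apply: le_trans (vhM 0 0 _); rewrite // in_itv/= lexx T0.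
pose K := L + d%:R * (2 * N / h * (2 * M)).
have K0 : 0 <= K.
  by rewrite addr_ge0// !mulr_ge0// ?invr_ge0 ?(ltW h0).
exists K; split => //.
suff H s u y : 0 <= s -> s < u -> u <= T -> `|vh s y - vh u y| <= K * `|s - u|.
  move=> s u y; rewrite !in_itv/= => /andP[s0 sT] /andP[u0 uT].
  have [su|us|->] := ltgtP s u; first exact: H.
    by rewrite distrC (distrC s); exact: H.
  by rewrite !subrr normr0 mulr0.
move=> s0 su uT; have [xi [a [xisu Aa E _]]] := semidiscrete_mvt y s0 su uT.
have xiT : xi \in `[0, T].
  move: xisu; rewrite !in_itv/= => /andP[sr ru].
  by rewrite (le_trans s0 (ltW sr)) (le_trans (ltW ru) uT).
rewrite E normrM (distrC s); apply: ler_wpM2r => //.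
apply: (le_trans (ler_normD _ _)); apply: lerD; first exact: (cost_bound A1).
apply: (le_trans (ler_norm_sum _ _ _)).
rewrite -(@sumr_cst_ord R d); apply: ler_sum => i _.
have [k1 k2] := weight_ge0 y i xiT Aa.
have D1 := vhM xi (y + h *: evec R i) xiT; have D2 := vhM xi (y - h *: evec R i) xiT.
have D3 := vhM xi y xiT.
apply: (le_trans (ler_normD _ _)); rewrite !normrM (ger0_norm k1) (ger0_norm k2).
have E1 : `|vh xi (y + h *: evec R i) - vh xi y| <= 2 * M.
  by move: D1 D3; rewrite !ler_norml; lra.
have E2 : `|vh xi (y - h *: evec R i) - vh xi y| <= 2 * M.
  by move: D2 D3; rewrite !ler_norml; lra.
by have := ler_wpM2l k1 E1; have := ler_wpM2l k2 E2; lra.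
Qed.

Lemma dist_sqr_shift x y i k :
  dotv (x - (y + k *: evec R i)) (x - (y + k *: evec R i)) =
  dotv (x - y) (x - y) - 2 * k * (x - y) 0 i + k ^+ 2.
Proof.
have -> : x - (y + k *: evec R i) = (x - y) + (- k) *: evec R i.
  by rewrite opprD addrA scaleNr.
have E1 : dotv (x - y) ((- k) *: evec R i) = - k * (x - y) 0 i.
  by rewrite dotvC dotvZl dotvC dotv_evec.
have E2 : dotv ((- k) *: evec R i) ((- k) *: evec R i) = k ^+ 2.
  by rewrite dotvZl dotvC dotvZl dotv_evec mxE !eqxx /=; ring.
by rewrite dotvDD E1 E2; ring.
Qed.

(* If [sigma w] minus the quadratic [|x - .|^2 / (2 ep)] is almost maximal at [y],
   then [sigma upwind] is at most the Hamiltonian at momentum [(x - y) / ep]. *)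
Lemma upwind_touching (sigma ep e : R) a t x y (w : 'rV[R]_d -> R) :
  0 < ep -> t \in `[0, T] -> A a ->
  (forall y', sigma * (w y' - w y) <=
     (dotv (x - y') (x - y') - dotv (x - y) (x - y)) / (2 * ep) + e) ->
  sigma * upwind N h c f a t y w <=
    sigma * c t y a - dotv (ep^-1 *: (x - y)) (f t y a)
    + d%:R * (N * h / ep) + d%:R * (2 * N / h * e).
Proof.
move=> ep0 tT Aa touch.
rewrite /upwind mulrDr -!addrA lerD2l mulr_sumr !addrA.
rewrite -!(@sumr_cst_ord R d) dotvZl /dotv mulr_sumr -sumrN -!big_split/=; apply: ler_sum => i _.
have [k1 k2] := weight_ge0 y i tT Aa.
have := touch (y + h *: evec R i); have := touch (y - h *: evec R i).
rewrite -scaleNr !dist_sqr_shift.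
set Q := dotv _ _; set z := (x - y) 0 i; set wp := w (y + _); set wm := w (y + _).
move=> tm tp.
have := ler_wpM2l k1 tp; have := ler_wpM2l k2 tm.
set F := f t y a 0 i; move=> Hm Hp.
(* The touching inequalities are added with the two weights: their difference [F / h] produces the
   drift term, their sum [2 * N / h] the terms in [N * h / ep] and [e]. *)
have -> : - (ep^-1 * (z * F)) + N * h / ep + 2 * N / h * e =
    (F / (2 * h) + N / h) * ((Q - 2 * h * z + h ^+ 2 - Q) / (2 * ep) + e) +
    (N / h - F / (2 * h)) * ((Q - 2 * - h * z + (- h) ^+ 2 - Q) / (2 * ep) + e).
  by field; rewrite !gt_eqF.
by move: Hm Hp; lra.
Qed.

End Semidiscrete.

(** * Doubling of the space variable *)

Section Doubling.
Context {R : realType} {d m : nat} {N h L T : R} {A : set 'rV[R]_m}.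
Context {c : R -> 'rV[R]_d -> 'rV[R]_m -> R}.
Context {f : R -> 'rV[R]_d -> 'rV[R]_m -> 'rV[R]_d} {q : 'rV[R]_d -> R}.
Context {alpha : R -> 'rV[R]_d -> 'rV[R]_d -> 'rV[R]_m}.
Context {alpha0 : R -> 'rV[R]_d -> 'rV[R]_m} {vh : R -> 'rV[R]_d -> R}.
Variables (a0 : 'rV[R]_m) (dl Lv ep sigma : R).
Hypotheses (L0 : 0 <= L) (N0 : 0 <= N) (h0 : 0 < h).
Hypothesis A1 : assumption_A1 L T A c f q.
Hypothesis A2 : assumption_A2 L T A c f alpha alpha0.
Hypothesis f_le : forall t x a, t \in `[0, T] -> A a -> enorm (f t x a) <= 2 * N.
Hypothesis vh_sol : semidiscrete_solution N h T A c f q vh.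
Hypotheses (Aa0 : A a0) (dl_gt0 : 0 < dl).
Hypothesis dl_small : d%:R * L * dl <= 2^-1.
Hypotheses (Lv0 : 0 <= Lv) (ep0 : 0 < ep) (sigma1 : sigma = 1 \/ sigma = -1).
Local Notation v := (value_function T A c f q).
Hypothesis v_lip : forall t x y, t \in `[0, T] -> `|v t x - v t y| <= Lv * enorm (x - y).
Implicit Types (s t u r : R) (x y z : 'rV[R]_d) (a b : 'rV[R]_m).

Definition penalized s x y : R :=
  sigma * (vh s y - v s x) - enorm (x - y) ^+ 2 / (2 * ep).

Let P := 2 * (Lv + 1).
Let P0 : 0 <= P. Proof. by rewrite /P; move: Lv0; lra. Qed.

(** The first term is the numerical viscosity acting on the quadratic penalty. The second is the
    change of the Hamiltonian between [x] and [y], with [P] bounding the momentum and [ep * P] the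
    distance. *)
Definition growth_rate := d%:R * (N * h / ep) + L * (1 + P) * (ep * P).

Lemma sigma_mul_le (k l : R) : `|k| <= l -> sigma * k <= l.
Proof. by rewrite ler_norml => /andP[? ?]; case: sigma1 => ->; lra. Qed.

Lemma penalized_ub s : s \in `[0, T] -> has_sup (range (fun xy => penalized s xy.1 xy.2)).
Proof.
move=> sT; have [s0 sT'] : 0 <= s /\ s <= T by move: sT; rewrite in_itv/= => /andP[].
have [[M vhM] _] := vh_sol; split; first by exists (penalized s 0 0), (0, 0).
exists (M + (L * T + L)) => _ [[x y] _ <-]; rewrite /penalized/=.
have q0 : 0 <= enorm (x - y) ^+ 2 / (2 * ep).
  by rewrite divr_ge0 ?sqr_ge0// mulr_ge0// ltW.
have := sigma_mul_le (vhM s y sT).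
have := sigma_mul_le (_ : `|- v s x| <= L * T + L).
rewrite normrN => /(_ (value_norm L0 A1 Aa0 dl_gt0 dl_small x s0 sT')).
by lra.
Qed.

(** The same control [b] stands on both sides, so only the shifts in time and space cost something.
    The passage goes through the point [x] at time [xi]. *)
Lemma ham_shift s x y z b r xi (p : 'rV[R]_d) (de : R) :
  r \in `[0, T] -> xi \in `[0, T] -> A b -> enorm p <= P -> `|xi - r| <= de ->
  (forall i, `|z 0 i - x 0 i| <= L * de) ->
  sigma * c xi y b - dotv p (f xi y b) <=
  sigma * c r z b - dotv p (f r z b)
    + L * (1 + P) * (de + d%:R * (L * de) + enorm (x - y)).
Proof.
move=> rT xiT Ab pP rxi zx; set e := enorm (x - y).
have zx' : enorm (x - z) <= d%:R * (L * de).
  rewrite enormB; apply: (le_trans (enorm_le_l1norm _)); apply: l1norm_le_cst => i.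
  by rewrite !mxE.
have key k1 k2 : k1 <= L * (0 + e + 0) -> k2 <= L * (`|xi - r| + enorm (x - z) + 0) ->
    k1 + k2 <= L * (de + d%:R * (L * de) + e).
  move=> h1 h2; apply: (le_trans (lerD h1 h2)); rewrite -mulrDr; apply: ler_wpM2l => //.
  lra.
have cc : sigma * (c xi y b - c r z b) <= L * (de + d%:R * (L * de) + e).
  have -> : c xi y b - c r z b = (c xi y b - c xi x b) + (c xi x b - c r z b) by lra.
  rewrite mulrDr; apply: key; apply: sigma_mul_le.
    have := cost_lip A1 y x xiT xiT Ab Ab.
    by rewrite !subrr normr0 enorm0 (enormB y).
  have := cost_lip A1 x z xiT rT Ab Ab.
  by rewrite !subrr enorm0.
have ff : - dotv p (f xi y b - f r z b) <= P * (L * (de + d%:R * (L * de) + e)).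
  have -> : f xi y b - f r z b = (f xi y b - f xi x b) + (f xi x b - f r z b).
    by rewrite addrA subrK.
  rewrite dotvDr opprD.
  have dl1 w : - dotv p w <= P * enorm w.
    apply: (le_trans (ler_norm _)); rewrite normrN; apply: (le_trans (dotv_le _ _)).
    by apply: ler_wpM2r => //; exact: enorm_ge0.
  apply: (le_trans (lerD (dl1 _) (dl1 _))); rewrite -mulrDr; apply: ler_wpM2l => //.
  apply: key.
    have := drift_lip A1 y x xiT xiT Ab Ab.
    by rewrite !subrr normr0 enorm0 (enormB y).
  have := drift_lip A1 x z xiT rT Ab Ab.
  by rewrite !subrr enorm0.
move: ff; rewrite dotvBr; move: cc.
have -> : L * (1 + P) * (de + d%:R * (L * de) + e) =
  L * (de + d%:R * (L * de) + e) + P * (L * (de + d%:R * (L * de) + e)) by ring.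
by move: (L * (de + _ + _)) (P * _) => k1 k2; lra.
Qed.

(** The increments of [vh] and [v] are compared at an almost maximal pair at time [s]. The constant
    [ka] may depend on [h] and [ep], as it multiplies the square of the step. *)
Lemma penalized_step : exists ka de1 : R, [/\ 0 <= ka, 0 < de1 &
  forall s u, 0 <= s -> s < u -> u <= T -> u - s <= de1 ->
  forall B, (forall x y, penalized u x y <= B) ->
  forall x y, penalized s x y <= B + (u - s) * (growth_rate + ka * (u - s))].
Proof.
have [Kh [Kh0 vht]] := semidiscrete_time_lip L0 N0 h0 A1 A2 f_le vh_sol.
pose ka := 2 + d%:R * (2 * N / h * (1 + 2 * Kh)) + L * (1 + P) * (1 + d%:R * L)
  + d%:R * L ^+ 2 / (2 * ep).
have ka0 : 0 <= ka.
  have k1 : 0 <= 1 + 2 * Kh by rewrite addr_ge0 ?mulr_ge0.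
  have k2 : 0 <= 1 + P by rewrite addr_ge0.
  have k3 : 0 <= 1 + d%:R * L by rewrite addr_ge0 ?mulr_ge0.
  have [h0' ep0'] := (ltW h0, ltW ep0).
  have k4 : 0 <= d%:R * (2 * N / h * (1 + 2 * Kh)).
    by rewrite mulr_ge0// mulr_ge0// divr_ge0// mulr_ge0.
  have k5 : 0 <= L * (1 + P) * (1 + d%:R * L) by rewrite !mulr_ge0.
  have k6 : 0 <= d%:R * L ^+ 2 / (2 * ep).
    by rewrite divr_ge0// mulr_ge0// sqr_ge0.
  by rewrite /ka !addr_ge0.
(* [dl] allows the dynamic programming step, [1] gives [de ^+ 2 <= de], and [ep] then gives
   [de ^+ 2 <= ep]. *)
pose de1 := Num.min dl (Num.min 1 ep).
have de10 : 0 < de1 by rewrite !lt_min dl_gt0 ltr01 ep0.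
exists ka, de1; split => // s u s0 su uT; rewrite !le_min => /and3P[usdl us1 usep] B HB.
set de := u - s in usdl us1 usep *; have de0 : 0 < de by rewrite /de subr_gt0.
have sT : s \in `[0, T] by rewrite in_itv/= s0 (le_trans (ltW su) uT).
have ub := penalized_ub sT.
(* The supremum need not be attained on the whole space; the tolerance [de ^+ 2] is of the order
   absorbed by [ka]. *)
have [_ [[x y] _ <-] /=] := sup_adherent (exprn_gt0 2 de0) ub.
set S := sup _ => near_sup.
have FS x' y' : penalized s x' y' <= S.
  by apply: (sup_upper_bound ub); exists (x', y').
have F1 x' y' : penalized s x' y' <= penalized s x y + de ^+ 2.
  by have := FS x' y'; lra.
suff main : penalized s x y + de ^+ 2 <= B + de * (growth_rate + ka * de).
  by move=> x' y'; exact: le_trans (F1 x' y') main.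
clear near_sup; set z := enorm (x - y); have z0 : 0 <= z by exact: enorm_ge0.
have zP : z <= ep * P.
  (* Comparison with the diagonal pair [(y, y)] gives [z ^+ 2 / (2 * ep) <= Lv * z + de ^+ 2], which
     bounds [z] since [de ^+ 2 <= ep]. *)
  have := F1 y y; rewrite /penalized subrr enorm0 expr0n/= mul0r subr0 -/z.
  have := sigma_mul_le (v_lip y x sT); rewrite enormB -/z => hv hF.
  have hz : z ^+ 2 / (2 * ep) <= Lv * z + de ^+ 2 by lra.
  rewrite ler_pdivrMr ?mulr_gt0// in hz.
  have de2 : de ^+ 2 <= ep.
    by rewrite expr2; apply: (le_trans _ usep); rewrite ger_pMr.
  rewrite leNgt; apply/negP; rewrite /P => zP.
  have epLv : 0 <= ep * Lv by rewrite mulr_ge0// ltW.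
  have z2 : 2 * ep <= z by lra.
  have z3 : 2 * ep <= z - 2 * (ep * Lv) by lra.
  have p1 := ler_wpM2l z0 z3.
  have p2 := ler_wpM2r (ltW ep0) z2.
  have p3 := ler_wpM2r (ltW ep0) de2.
  have p4 : 0 < ep * ep by rewrite mulr_gt0.
  by move: hz p1 p2 p3 p4; rewrite expr2; lra.
set p := ep^-1 *: (x - y).
have pE : enorm p <= P.
  rewrite /p enormZ; last by rewrite invr_ge0 ltW.
  by rewrite ler_pdivrMl.
have [xi [a [xisu Aa E amin]]] := semidiscrete_mvt h0 A2 vh_sol y s0 su uT.
have [sxi xiu] : s < xi /\ xi < u by move: xisu; rewrite in_itv/= => /andP[].
have xiT : xi \in `[0, T] by rewrite in_itv/= (le_trans s0 (ltW sxi)) (le_trans (ltW xiu) uT).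
(* The control passed on is the minimizer [a] of the scheme at [xi]; for [sigma = -1] it is the
   constant control along the path. *)
have [J [D [hJ hD hG]]] := value_step L0 A1 Aa0 dl_gt0 dl_small x sigma1 s0 (ltW su) uT
  usdl Aa (exprn_gt0 2 de0).
set U := upwind N h c f a xi y (vh xi) in E amin.
pose E1 := d%:R * (2 * N / h * (de ^+ 2 + 2 * (Kh * de)))
  + L * (1 + P) * (de + d%:R * (L * de) + z).
have GU : (sigma * U - d%:R * (N * h / ep) - E1) * de <= sigma * J - dotv p D.
  apply: hG => b r zz Ab sb rsu zzx.
  have [sr ru] : s <= r /\ r <= u by move: rsu; rewrite in_itv/= => /andP[].
  have rT : r \in `[0, T] by rewrite in_itv/= (le_trans s0 sr) (le_trans ru uT).
  (* For [sigma = 1] this is the minimality of [a] against an arbitrary [b]; for [sigma = -1] the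
     two controls coincide. *)
  have Ub : sigma * U <= sigma * upwind N h c f b xi y (vh xi).
    by case: sb => [->|->//]; rewrite !mul1r; exact: amin.
  (* Almost maximality holds at time [s], whereas the scheme is evaluated at [xi]; moving [vh] at
     both points costs [2 * (Kh * de)]. *)
  have touch y' : sigma * (vh xi y' - vh xi y) <=
      (dotv (x - y') (x - y') - dotv (x - y) (x - y)) / (2 * ep)
      + (de ^+ 2 + 2 * (Kh * de)).
    have := F1 x y'; rewrite /penalized !enorm_sqr mulrBl.
    have le_de : `|xi - s| <= de.
      by rewrite ger0_norm ?subr_ge0 ?(ltW sxi)// /de lerD2r ltW.
    have t1 := sigma_mul_le (le_trans (vht xi s y' xiT sT) (ler_wpM2l Kh0 le_de)).
    rewrite distrC in le_de.
    have t2 := sigma_mul_le (le_trans (vht s xi y sT xiT) (ler_wpM2l Kh0 le_de)).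
    move: t1 t2 {F1 FS HB hJ}.
    move: (v s x) (vh s y) (vh s y') (vh xi y) (vh xi y') (Kh * de) => *; lra.
  have H1 := upwind_touching h0 f_le ep0 xiT Ab touch.
  have H2 : sigma * c xi y b - dotv p (f xi y b) <=
      sigma * c r zz b - dotv p (f r zz b) + L * (1 + P) * (de + d%:R * (L * de) + z).
    apply: ham_shift => //; rewrite ler_norml /de.
    by move: sxi xiu sr ru {Ub touch H1 hJ}; lra.
  by move: Ub (H1 c) H2 {touch hJ}; rewrite -/p /E1; move: (upwind _ _ _ _ b _ _ _) => k; lra.
(* At time [u] the first point has moved with the path to [x + D]. The cross term of the expanded
   square is exactly [dotv p D], matching the one in [GU]. *)
have HBu := HB (x + D) y; rewrite /penalized enorm_sqr in HBu.
have Exy : x + D - y = (x - y) + D by rewrite addrAC.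
rewrite Exy dotvDD -enorm_sqr -/z in HBu.
have pD : dotv (x - y) D = ep * dotv p D.
  by rewrite /p dotvZl mulrA divff ?mul1r// gt_eqF.
have DD : dotv D D <= d%:R * (L ^+ 2 * de ^+ 2).
  rewrite -(@sumr_cst_ord R d); apply: ler_sum => i _.
  rewrite -expr2 -exprMn -[X in X <= _]real_normK ?num_real//.
  by apply: lerXn2r; rewrite ?nnegrE ?mulr_ge0 ?(ltW de0)//; exact: hD.
rewrite pD in HBu.
have HBu' : sigma * (vh u y - v u (x + D)) <=
    B + z ^+ 2 / (2 * ep) + dotv p D + d%:R * L ^+ 2 / (2 * ep) * de ^+ 2.
  have e2 : (z ^+ 2 + 2 * (ep * dotv p D) + dotv D D) / (2 * ep) =
      z ^+ 2 / (2 * ep) + dotv p D + dotv D D / (2 * ep).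
    by field; rewrite gt_eqF.
  have : dotv D D / (2 * ep) <= d%:R * (L ^+ 2 * de ^+ 2) / (2 * ep).
    by apply: ler_wpM2r => //; rewrite invr_ge0 mulr_ge0// ltW.
  have -> : d%:R * (L ^+ 2 * de ^+ 2) / (2 * ep) = d%:R * L ^+ 2 / (2 * ep) * de ^+ 2.
    by field; rewrite gt_eqF.
  by rewrite e2 in HBu; lra.
have E1le : E1 <= L * (1 + P) * (ep * P) + de *
    (d%:R * (2 * N / h * (1 + 2 * Kh)) + L * (1 + P) * (1 + d%:R * L)).
  have Nh : 0 <= d%:R * (2 * N / h) by rewrite !mulr_ge0 ?invr_ge0 ?(ltW h0).
  have LP : 0 <= L * (1 + P) by rewrite mulr_ge0// addr_ge0.
  have i1 := ler_wpM2l LP zP.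
  have dede : de ^+ 2 <= de by rewrite expr2 ger_pMr.
  have i2 := ler_wpM2l Nh dede.
  have -> : E1 = d%:R * (2 * N / h) * de ^+ 2 + d%:R * (2 * N / h) * (2 * Kh * de)
     + L * (1 + P) * (de * (1 + d%:R * L)) + L * (1 + P) * z by rewrite /E1; ring.
  have -> : de * (d%:R * (2 * N / h * (1 + 2 * Kh)) + L * (1 + P) * (1 + d%:R * L)) =
     d%:R * (2 * N / h) * de + d%:R * (2 * N / h) * (2 * Kh * de)
     + L * (1 + P) * (de * (1 + d%:R * L)) by ring.
  by move: i1 i2; lra.
have E1le' := ler_wpM2l (ltW de0) E1le.
have -> : B + de * (growth_rate + ka * de) = B + de * (d%:R * (N * h / ep)) +
   de * (L * (1 + P) * (ep * P) + de * (d%:R * (2 * N / h * (1 + 2 * Kh))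
     + L * (1 + P) * (1 + d%:R * L)))
   + 2 * de ^+ 2 + d%:R * L ^+ 2 / (2 * ep) * de ^+ 2 by rewrite /growth_rate /ka; ring.
have PE : penalized s x y = sigma * (vh u y - v u (x + D)) + sigma * U * de
    + sigma * (J + v u (x + D) - v s x) - sigma * J - z ^+ 2 / (2 * ep).
  rewrite /penalized -/z; have -> : vh s y = vh u y + U * de by rewrite /de -E; ring.
  by ring.
have GU' : sigma * U * de - de * (d%:R * (N * h / ep)) - de * E1 <= sigma * J - dotv p D.
  by apply: le_trans GU; rewrite le_eqVlt; apply/orP; left; apply/eqP; ring.
rewrite PE; move: HBu' hJ GU' E1le' {HBu GU E1le F1 PE hG E amin}.
move: (v s x) (v u (x + D)) (vh u y) (dotv p D) U E1 => *; lra.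
Qed.

(** With [n] equal steps the quadratic errors add up to [ka * (T - t) ^+ 2 / n], which is
    arbitrarily small. *)
Lemma penalized_le B t x y : (forall x y, penalized T x y <= B) -> t \in `[0, T] ->
  penalized t x y <= B + (T - t) * growth_rate.
Proof.
move=> HB; rewrite in_itv/= => /andP[t0]; rewrite le_eqVlt => /predU1P[->|tT].
  by rewrite subrr mul0r addr0.
have [ka [de1 [ka0 de10 step]]] := penalized_step.
have iter n de : 0 < de -> de <= de1 -> forall s, 0 <= s -> s + n%:R * de = T ->
    forall x y, penalized s x y <= B + n%:R * de * (growth_rate + ka * de).
  move=> de0 dede; elim: n => [|n IH] s s0.
    rewrite mul0r addr0 => -> x' y'; rewrite mul0r addr0; exact: HB.
  rewrite -natr1 mulrDl mul1r => sT x' y'.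
  have eT : s + de + n%:R * de = T by rewrite -sT; ring.
  have nde : 0 <= n%:R * de by rewrite mulr_ge0// ltW.
  have ih := IH (s + de) (addr_ge0 s0 (ltW de0)) eT.
  have e : s + de - s = de by rewrite addrAC subrr add0r.
  have := step s (s + de) s0 _ _ _ _ ih x' y'; rewrite e.
  move=> /(_ _ _ dede) H; apply: (le_trans (H _ _)); [by rewrite ltrDl|lra|].
  by rewrite le_eqVlt; apply/orP; left; apply/eqP; ring.
apply/ler_addgt0Pr => e e0.
(* Any [n] above both summands makes the step at most [de1] and the total quadratic error at most
   [e]. *)
pose w := (T - t) / de1 + ka * (T - t) ^+ 2 / e.
have Tt0 : 0 < T - t by rewrite subr_gt0.
have [Tt0' [de10' e0']] := (ltW Tt0, (ltW de10, ltW e0)).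
have wl : 0 <= (T - t) / de1 by rewrite divr_ge0.
have wr : 0 <= ka * (T - t) ^+ 2 / e by rewrite divr_ge0// mulr_ge0// sqr_ge0.
have w0 : 0 <= w by rewrite addr_ge0.
have := archi_boundP w0; set n := Num.Def.archi_bound w => wn.
have n0 : 0 < n%:R :> R by exact: le_lt_trans wn.
have w1 : (T - t) / de1 <= n%:R.
  by apply: le_trans (ltW wn); rewrite lerDl.
have w2 : ka * (T - t) ^+ 2 / e <= n%:R.
  by apply: le_trans (ltW wn); rewrite lerDr.
have nde : n%:R * ((T - t) / n%:R) = T - t by rewrite mulrC divfK// gt_eqF.
have := iter n ((T - t) / n%:R) _ _ t t0 _ x y; rewrite nde => H.
apply: (le_trans (H _ _ _)).
- by rewrite divr_gt0.
- by rewrite ler_pdivrMr// mulrC -ler_pdivrMr.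
- by rewrite addrC subrK.
rewrite mulrDr addrA lerD2l.
have -> : (T - t) * (ka * ((T - t) / n%:R)) = ka * (T - t) ^+ 2 / n%:R.
  by field; rewrite gt_eqF.
by move: w2; rewrite !ler_pdivrMr// (mulrC e).
Qed.

(** At time [T] both functions equal [q]; completing the square bounds
    [L * z - z ^+ 2 / (2 * ep)]. *)
Lemma penalized_terminal x y : 0 <= T -> penalized T x y <= ep * L ^+ 2.
Proof.
move=> T0; have [_ [_ [_ vhT]]] := vh_sol.
rewrite /penalized vhT (value_terminal L0 A1 Aa0 dl_gt0 dl_small)//.
have := sigma_mul_le (terminal_lip A1 y x); rewrite enormB.
set z := enorm _ => hq; have -> : ep * L ^+ 2 = L * z - z ^+ 2 / (2 * ep) +
    (z - ep * L) ^+ 2 / (2 * ep) + ep * L ^+ 2 / 2.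
  by field; rewrite gt_eqF.
have ep0' := ltW ep0.
have : 0 <= (z - ep * L) ^+ 2 / (2 * ep) by rewrite divr_ge0 ?sqr_ge0 ?mulr_ge0.
have : 0 <= ep * L ^+ 2 / 2 by rewrite divr_ge0 ?mulr_ge0 ?sqr_ge0.
by move: hq; lra.
Qed.

(** The penalty vanishes on the diagonal. *)
Lemma value_gap t x : t \in `[0, T] ->
  sigma * (vh t x - v t x) <= ep * L ^+ 2 + (T - t) * growth_rate.
Proof.
move=> tT; have T0 : 0 <= T by move: tT; rewrite in_itv/= => /andP[]; exact: le_trans.
have := penalized_le x x (fun x y => penalized_terminal x y T0) tT.
by rewrite {1}/penalized subrr enorm0 expr0n/= mul0r subr0.
Qed.

End Doubling.

(** * Choice of the penalty parameter and final constants *)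

(** This [ep] balances [N * h / ep] against [ep * (1 + Lv) ^+ 2]: both are of order
    [(1 + Lv) * Num.sqrt h]. *)
Lemma optimized_rate (R : realType) (d : nat) (N h L T Lv t : R) :
  0 <= N -> 0 <= L -> 0 < h -> 0 <= Lv -> 0 <= t -> t <= T ->
  let ep := Num.sqrt h / (1 + Lv) in
  ep * L ^+ 2 + (T - t) * @growth_rate R d N h L Lv ep <=
  (L ^+ 2 + 6 * L + d%:R * N + 1) * (1 + T) * (1 + Lv) * Num.sqrt h.
Proof.
move=> N0 L0 h0 Lv0 t0 tT /=; set w := Num.sqrt h.
have w0 : 0 < w by rewrite sqrtr_gt0.
have hw : h = w ^+ 2 by rewrite sqr_sqrtr// ltW.
have l0 : 0 < 1 + Lv by rewrite ltr_pwDl.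
have wl : 0 <= w * (1 + Lv) by rewrite ltW// mulr_gt0.
have -> : w / (1 + Lv) * L ^+ 2 + (T - t) * @growth_rate R d N h L Lv (w / (1 + Lv)) =
    w * L ^+ 2 / (1 + Lv) + (T - t) * (w * (1 + Lv) * (d%:R * N) + 2 * L * w * (3 + 2 * Lv)).
  by rewrite /growth_rate hw; field; rewrite !gt_eqF.
have i1 : w * L ^+ 2 / (1 + Lv) <= w * (1 + Lv) * L ^+ 2.
  rewrite ler_pdivrMr//; have := sqr_ge0 L; move: (L ^+ 2) => k k0.
  have wk : 0 <= w * k by rewrite mulr_ge0// ltW.
  have : 0 <= w * k * Lv by rewrite mulr_ge0.
  have : 0 <= w * k * (Lv * Lv) by rewrite mulr_ge0// mulr_ge0.
  lra.
have i2 : w * (1 + Lv) * (d%:R * N) + 2 * L * w * (3 + 2 * Lv) <=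
    w * (1 + Lv) * (d%:R * N + 6 * L).
  have : 0 <= L * w * Lv by rewrite !mulr_ge0// ltW.
  lra.
have dN : 0 <= d%:R * N by rewrite mulr_ge0.
have g0 : 0 <= w * (1 + Lv) * (d%:R * N + 6 * L).
  by rewrite mulr_ge0// addr_ge0// mulr_ge0.
have i3 : (T - t) * (w * (1 + Lv) * (d%:R * N) + 2 * L * w * (3 + 2 * Lv)) <=
    (1 + T) * (w * (1 + Lv) * (d%:R * N + 6 * L)).
  apply: (@le_trans _ _ ((T - t) * (w * (1 + Lv) * (d%:R * N + 6 * L)))).
    by apply: ler_wpM2l => //; rewrite subr_ge0.
  by apply: ler_wpM2r => //; lra.
have i4 : w * (1 + Lv) * L ^+ 2 <= (1 + T) * (w * (1 + Lv) * (L ^+ 2 + 1)).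
  have k0 : 0 <= w * (1 + Lv) * (L ^+ 2 + 1) by rewrite mulr_ge0// addr_ge0// sqr_ge0.
  apply: (@le_trans _ _ (w * (1 + Lv) * (L ^+ 2 + 1))).
    by apply: ler_wpM2l => //; rewrite lerDl.
  by apply: ler_peMl => //; rewrite lerDl (le_trans t0 tT).
apply: (le_trans (lerD (le_trans i1 i4) i3)).
by rewrite le_eqVlt; apply/orP; left; apply/eqP; ring.
Qed.

Lemma two_exp_le_expR (R : realType) (n : nat) : 2 ^+ n <= expR n%:R :> R.
Proof.
rewrite -[n%:R]mulr1 expRM_natl; apply: lerXn2r; rewrite ?nnegrE ?expR_ge0//.
by have := expR_ge1Dx (1 : R); lra.
Qed.

(** Universality of [C] is expressed by choosing it before [m], [T], [h] and all the data. The
    solution [v] is taken as the value function, and any spatial Lipschitz constant [Lv] stands for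
    the norm of its gradient. *)
Theorem theorem3p4 (R : realType) (d : nat) (N L : R) :
  (0 < d)%N -> 1 <= N -> 0 <= L ->
  exists C : R, 0 < C /\
  forall (m : nat) (T h : R) (A : set 'rV[R]_m)
    (c : R -> 'rV[R]_d -> 'rV[R]_m -> R)
    (f : R -> 'rV[R]_d -> 'rV[R]_m -> 'rV[R]_d)
    (q : 'rV[R]_d -> R)
    (alpha : R -> 'rV[R]_d -> 'rV[R]_d -> 'rV[R]_m)
    (alpha0 : R -> 'rV[R]_d -> 'rV[R]_m)
    (vh : R -> 'rV[R]_d -> R),
    (0 < m)%N -> 1 <= T -> 0 < h < 1 -> compact A ->
    assumption_A1 L T A c f q ->
    assumption_A2 L T A c f alpha alpha0 ->
    (* N >= ||f||_oo / 2 *)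
    (forall t x a, t \in `[0, T] -> A a -> enorm (f t x a) <= 2 * N) ->
    semidiscrete_solution N h T A c f q vh ->
    let v := value_function T A c f q in
    (forall Lv : R, 0 <= Lv ->
       (forall t x y, t \in `[0, T] -> `|v t x - v t y| <= Lv * enorm (x - y)) ->
       forall t x, t \in `[0, T] ->
         `|v t x - vh t x| <= C * (1 + T) * (1 + Lv) * Num.sqrt h) /\
    (forall t x, t \in `[0, T] ->
       `|v t x - vh t x| <= C * expR (C * T) * Num.sqrt h).
Proof.
move=> d0 N1 L0; have N0 : 0 <= N by exact: le_trans N1.
(* The [+ 1] makes [dl] positive and at most [1], also when [L = 0]. *)
pose dl : R := (2 * (d%:R * L) + 1)^-1.
have dL0 : 0 <= d%:R * L by rewrite mulr_ge0.
have dl_gt0 : 0 < dl by rewrite invr_gt0; lra.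
have dl_le1 : dl <= 1 by rewrite invf_le1; lra.
have dl_small : d%:R * L * dl <= 2^-1 by rewrite /dl ler_pdivrMr; lra.
pose C0 := L ^+ 2 + 6 * L + d%:R * N + 1.
have C0ge1 : 1 <= C0.
  have : 0 <= d%:R * N by rewrite mulr_ge0.
  by have := sqr_ge0 L; rewrite /C0; lra.
pose k := 3 * L * d%:R * expR 1.
have k0 : 0 <= k by rewrite !mulr_ge0 ?expR_ge0.
(* [C0 * (1 + k)] serves as prefactor and [1 + dl^-1] as exponential rate; a single constant
   dominates both. *)
pose C := C0 * (1 + k) + (1 + dl^-1).
have dlV0 : 0 <= dl^-1 by rewrite invr_ge0 ltW.
have C0k : 0 <= C0 * k by rewrite mulr_ge0//; lra.
have CC0 : C0 <= C by rewrite /C; lra.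
exists C; split; first by lra.
move=> m T h A c f q alpha alpha0 vh _ T1 /andP[h0 _] _ A1 A2 f_le vh_sol v.
have T0 : 0 <= T by lra.
have zT : (0 : R) \in `[0, T] by rewrite in_itv/= lexx T0.
(* The minimizer at the origin shows that [A] is nonempty. *)
have [Aa0 _] := A2.1 0 0 0 zT.
have rate Lv : 0 <= Lv ->
    (forall t x y, t \in `[0, T] -> `|v t x - v t y| <= Lv * enorm (x - y)) ->
    forall t x, t \in `[0, T] ->
    `|v t x - vh t x| <= C0 * (1 + T) * (1 + Lv) * Num.sqrt h.
  move=> Lv0 v_lip t x tT.
  have [t0 tT'] : 0 <= t /\ t <= T by move: tT; rewrite in_itv/= => /andP[].
  have ep0 : 0 < Num.sqrt h / (1 + Lv) by rewrite divr_gt0 ?sqrtr_gt0//; lra.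
  have bound := optimized_rate d N0 L0 h0 Lv0 t0 tT'.
  have up := value_gap L0 N0 h0 A1 A2 f_le vh_sol Aa0 dl_gt0 dl_small Lv0 ep0
    (or_introl erefl) v_lip x tT.
  have low := value_gap L0 N0 h0 A1 A2 f_le vh_sol Aa0 dl_gt0 dl_small Lv0 ep0
    (or_intror erefl) v_lip x tT.
  have := le_trans up bound; have := le_trans low bound.
  by rewrite -/v -/C0 ler_norml => ? ?; apply/andP; split; lra.
have w0 : 0 <= Num.sqrt h by exact: sqrtr_ge0.
split=> [Lv Lv0 v_lip t x tT|t x tT].
  apply: (le_trans (rate Lv Lv0 v_lip t x tT)).
  by do 3 (apply: ler_wpM2r; first by lra).
(* [n] intervals of length [dl] cover [[0, T]]. As [n <= T / dl + 1], [2 ^+ n] is at most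
   [expR 1 * expR (T / dl)], whence the factor [expR 1] in [k]. *)
pose n := (Num.truncn (T / dl)).+1.
have Tdl : 0 <= T / dl by rewrite mulr_ge0.
have /andP[nlo nhi] := truncn_itv Tdl.
have Tn : T <= n%:R * dl by rewrite -ler_pdivrMr// ltW.
pose Lv := 3 * L * 2 ^+ n * d%:R.
have Lv0 : 0 <= Lv by rewrite !mulr_ge0// exprn_ge0.
have v_lip s x' y' : s \in `[0, T] -> `|v s x' - v s y'| <= Lv * enorm (x' - y').
  rewrite in_itv/= => /andP[s0 sT].
  apply: (value_lip L0 A1 Aa0 dl_gt0 dl_le1 dl_small x' y' s0 sT).
  by apply: le_trans Tn; rewrite gerBl.
apply: (le_trans (rate Lv Lv0 v_lip t x tT)); apply: ler_wpM2r => //.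
have eT1 : 1 + T <= expR T by exact: expR_ge1Dx.
have edl1 : 1 <= expR (T * dl^-1) by have := expR_ge1Dx (T * dl^-1); lra.
have Lvk : 1 + Lv <= (1 + k) * expR (T * dl^-1).
  have : 2 ^+ n <= expR 1 * expR (T * dl^-1) :> R.
    apply: (le_trans (two_exp_le_expR R n)); rewrite -expRD ler_expR /n -natr1.
    by rewrite addrC lerD2l.
  have k' : 0 <= 3 * L * d%:R by rewrite !mulr_ge0.
  move=> /(ler_wpM2l k'); rewrite /k /Lv.
  lra.
have expE : expR T * expR (T * dl^-1) <= expR (C * T).
  rewrite -expRD ler_expR.
  have -> : T + T * dl^-1 = (1 + dl^-1) * T by ring.
  apply: ler_wpM2r => //; rewrite /C; lra.
apply: (@le_trans _ _ (C0 * (1 + k) * expR (C * T))); last first.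
  apply: ler_wpM2r; first exact: expR_ge0.
  rewrite /C; lra.
apply: (@le_trans _ _ (C0 * (1 + k) * (expR T * expR (T * dl^-1)))); last first.
  by apply: ler_wpM2l => //; lra.
have -> : C0 * (1 + k) * (expR T * expR (T * dl^-1)) =
  C0 * expR T * ((1 + k) * expR (T * dl^-1)) by ring.
apply: ler_pM => //; [by rewrite mulr_ge0; lra|lra|].
by apply: ler_wpM2l => //; lra.
Qed.
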